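(* Let $d\ge3$ and $N\ge2$. The set $$\mathcal U=\bigcup_{c\in\mathbb R^d}\{\Psi\in\mathcal S:\varkappa_c(\Psi)<N^{1/d}\}$$ is open in $(\mathcal S,d_2)$, disjoint from the closure of $\mathcal G_T$, and contained in $\{\Psi\in\mathcal S:\lambda_{\max}(\Psi)>N^{-1/d}\}$. If $\Omega$ is convex, $c\in\Omega$, and $N^{-1/d}<r<1$, then there is $\varepsilon>0$, depending only on $r$, $N$, and $d$, such that the homotheties $\varphi_i(x)=r(x-c_i)+c_i$, $i\in\mathcal I$, with $c_i\in\Omega$ and $|c_i-c|<\varepsilon$ form a member of $\mathcal U$. In particular, $\mathcal G_T$ is not dense in $(\mathcal S,d_2)$ when $\Omega$ is convex.
   Context: Let $d\ge3$. A domain is a nonempty connected open set. M\''obius transformations of $\mathbb R^d\cup\{\infty\}$ are finite compositions of similarities $x\mapsto\lambda Ox+b$ ($\lambda>0$, $O\in O(d)$) and inversions in spheres. Conformal maps of domains in $\mathbb R^d$ are (Liouville) restrictions of M\''obius transformations and are identified with them. Fix $\mathcal I=\{1,\dots,N\}$, a bounded domain $\Omega\subset\mathbb R^d$ and a domain $\Omega'$ with $\overline\Omega\subset\Omega'\subset\mathbb R^d$. $\mathcal S$ is the set of conformal iterated function systems on $\Omega$ with extension domain $\Omega'$: tuples $\Phi=(\varphi_i)_{i\in\mathcal I}$ of conformal maps $\varphi_i:\Omega'\to\mathbb R^d$ with $\varphi_i(\overline\Omega)\subset\Omega$ and $\|D\varphi_i\|<1$ (operator norm) on $\overline\Omega$.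 Its metric is $d_2(\Phi,\Psi)=\max_i(\|\varphi_i-\psi_i\|+\|D\varphi_i-D\psi_i\|+\|D^2\varphi_i-D^2\psi_i\|)$, norms being suprema over $\overline\Omega$ (of operator norms). $\lambda_{\max}(\Phi)=\max_i\sup_{\overline\Omega}\|D\varphi_i\|$. For a finite word $\mathtt i=i_1\cdots i_n$ put $f_{\mathtt i}=\varphi_{i_n}\circ\cdots\circ\varphi_{i_1}$ and $T_{\mathtt i}=\nabla\log\|Df_{\mathtt i}\|$ on $\overline\Omega$; for an infinite word, $T_{\mathtt i}$ is the uniform limit on $\overline\Omega$ of $T_{\mathtt i|_n}$, with $\mathtt i|_n$ the length-$n$ prefix (the limit exists). With $\mathcal I^*$ the finite and $\mathcal I^{\mathbb N}$ the infinite words and $|\cdot|$ the length, $Z=\{(\mathtt i,\mathtt j)\in(\mathcal I^{\mathbb N}\cup\mathcal I^* )^2:|\mathtt i|=|\mathtt j|\ge1,\ i_1\ne j_1\}$ and $\mathcal G_T=\{\Phi\in\mathcal S:\inf_{(\mathtt i,\mathtt j)\in Z}\sup_{\overline\Omega}|T_{\mathtt i}-T_{\mathtt j}|>0\}$. Chordal stretch: the chordal factor of a M\''obius transformation $f$ is $f^{\#}(x)=\|Df(x)\|\frac{1+|x|^2}{1+|f(x)|^2}$, extended continuously to a positive function on $\mathbb R^d\cup\{\infty\}$. With $\tau_c(x)=x+c$, $\varkappa_c(\Phi)=\max_{i\in\mathcal I}\sup_{x\in\mathbb R^d\cup\{\infty\}}(\tau_{-c}\circ\varphi_i\circ\tau_c)^{\#}(x)$.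 *)

(* Defs.v *)
From HB Require Import structures.
From mathcomp Require Import all_boot all_order all_algebra.
From mathcomp Require Import all_classical all_reals all_analysis.

Set Implicit Arguments.
Unset Strict Implicit.
Unset Printing Implicit Defensive.
Import Order.TTheory GRing.Theory Num.Theory.
Import numFieldNormedType.Exports.

Local Open Scope classical_set_scope.
Local Open Scope ring_scope.

(* R^d is ['rV[R]_d]. Its library norm is the sup norm; it is used here only
   through the topology and boundedness, and [enorm] is the Euclidean norm. *)
Section EuclideanNorm.
Context {R : realType} {d : nat}.
Implicit Types (u v w : 'rV[R]_d) (A B C : 'M[R]_d).

Definition enorm v : R := Num.sqrt (\sum_j v 0 j ^+ 2).

(* Matrices act on row vectors from the right, as in the library Jacobian
   ['J f x], for which [v *m 'J f x = 'd f x v]. *)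
Definition opnorm A : R := sup [set enorm (v *m A) | v in [set v | enorm v <= 1]].

(* Operator norm of the bilinear map (u, v) |-> v *m B u. *)
Definition opnorm2 (B : 'rV[R]_d -> 'M[R]_d) : R :=
  sup [set r | exists u v, [/\ enorm u <= 1, enorm v <= 1 & r = enorm (v *m B u)]].

Lemma enorm_ge0 v : 0 <= enorm v. Proof. exact: sqrtr_ge0. Qed.

Let sumsq_ge0 v : 0 <= \sum_j v 0 j ^+ 2.
Proof. by apply: sumr_ge0 => j _; exact: sqr_ge0. Qed.

Lemma enorm_sqr v : enorm v ^+ 2 = \sum_j v 0 j ^+ 2.
Proof. exact: sqr_sqrtr. Qed.

Lemma enorm0 : enorm 0 = 0.
Proof.
by rewrite /enorm big1 ?sqrtr0// => j _; rewrite mxE expr0n.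
Qed.

Lemma enormZ a v : enorm (a *: v) = `|a| * enorm v.
Proof.
rewrite /enorm -sqrtr_sqr -sqrtrM ?sqr_ge0//; congr Num.sqrt.
by rewrite mulr_sumr; apply: eq_bigr => j _; rewrite mxE exprMn.
Qed.

Lemma enormN v : enorm (- v) = enorm v.
Proof. by rewrite -scaleN1r enormZ normrN normr1 mul1r. Qed.

Lemma coord_le_enorm v j : `|v 0 j| <= enorm v.
Proof.
rewrite -sqrtr_sqr ler_sqrt // (bigD1 j)//= lerDl.
by apply: sumr_ge0 => i _; exact: sqr_ge0.
Qed.

Lemma enorm_eq0 v : enorm v = 0 -> v = 0.
Proof.
move=> v0; apply/rowP => j; rewrite mxE; apply/eqP.
by rewrite -normr_le0 -v0 coord_le_enorm.
Qed.

Lemma enorm_dot u v : \sum_j u 0 j * v 0 j <= enorm u * enorm v.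
Proof.
have [/enorm_eq0 ->|u0] := eqVneq (enorm u) 0.
  by rewrite big1 ?mulr_ge0 ?enorm_ge0// => j _; rewrite mxE mul0r.
have [/enorm_eq0 ->|v0] := eqVneq (enorm v) 0.
  by rewrite big1 ?mulr_ge0 ?enorm_ge0// => j _; rewrite mxE mulr0.
have uv : 0 < enorm u * enorm v.
  by rewrite mulr_gt0// lt_neqAle eq_sym ?u0 ?v0 enorm_ge0.
have : 0 <= \sum_j (enorm v * u 0 j - enorm u * v 0 j) ^+ 2.
  by apply: sumr_ge0 => j _; exact: sqr_ge0.
under eq_bigr => j _ do
  rewrite sqrrB !exprMn [X in X *+ 2]mulrACA (mulrC (enorm v) (enorm u)) -mulrnAl.
rewrite big_split/= sumrB -!mulr_sumr -!enorm_sqr.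
rewrite mulrC addrAC -mulr2n mulrnAl -mulrnBl -exprMn expr2 -mulrBr.
by rewrite pmulrn_lge0// pmulr_rge0// subr_ge0.
Qed.

Lemma enormD u v : enorm (u + v) <= enorm u + enorm v.
Proof.
rewrite -(@ler_pXn2r _ 2)// ?nnegrE ?addr_ge0 ?enorm_ge0//.
rewrite enorm_sqr sqrrD !enorm_sqr.
under eq_bigr => j _ do rewrite mxE sqrrD -mulr_natl.
by rewrite !big_split/= lerD2r lerD2l -mulr_sumr mulr_natl lerMn2r enorm_dot.
Qed.

Lemma enorm_distD u v w : enorm (u - w) <= enorm (u - v) + enorm (v - w).
Proof. by rewrite -[u - w](subrKA v) enormD. Qed.

Lemma enorm_sum (I : finType) (F : I -> 'rV[R]_d) :
  enorm (\sum_i F i) <= \sum_i enorm (F i).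
Proof.
elim/big_ind2 : _ => [|x a y b xa yb|//]; first by rewrite enorm0.
exact: le_trans (enormD _ _) (lerD xa yb).
Qed.

Lemma enorm_lincomb v (F : 'I_d -> 'rV[R]_d) : enorm v <= 1 ->
  enorm (\sum_i v 0 i *: F i) <= \sum_i enorm (F i).
Proof.
move=> v1; apply: le_trans (enorm_sum _) _; apply: ler_sum => i _.
by rewrite enormZ ler_piMl ?enorm_ge0// (le_trans (coord_le_enorm _ _)).
Qed.

Lemma opnorm_has_ubound A :
  has_ubound [set enorm (v *m A) | v in [set v | enorm v <= 1]].
Proof.
exists (\sum_i enorm (row i A)) => _ [v /= v1 <-].
by rewrite mulmx_sum_row enorm_lincomb.
Qed.

Lemma enorm_le_opnorm A v : enorm v <= 1 -> enorm (v *m A) <= opnorm A.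
Proof. by move=> v1; apply: ub_le_sup; [exact: opnorm_has_ubound|exists v]. Qed.

Lemma opnormN A : opnorm (- A) = opnorm A.
Proof.
by congr sup; apply: eq_imagel => v _; rewrite mulmxN enormN.
Qed.

Lemma opnormB A B : opnorm (A - B) = opnorm (B - A).
Proof. by rewrite -opnormN opprB. Qed.

Lemma opnorm0 : opnorm 0 = 0.
Proof.
rewrite /opnorm (_ : image _ _ = [set 0]) ?sup1//.
apply/seteqP; split=> [_ [v _ <-]|_ ->] /=; first by rewrite mulmx0 enorm0.
by exists 0; rewrite /= ?mul0mx enorm0.
Qed.

Lemma opnormD A B : opnorm (A + B) <= opnorm A + opnorm B.
Proof.
apply: ge_sup => [|_ [v /= v1 <-]].
  by exists (enorm (0 *m (A + B))); exists 0; rewrite //= enorm0.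
by rewrite mulmxDr (le_trans (enormD _ _))// lerD// enorm_le_opnorm.
Qed.

Lemma opnorm_distD A B C : opnorm (A - C) <= opnorm (A - B) + opnorm (B - C).
Proof. by rewrite -[A - C](subrKA B) opnormD. Qed.

Lemma opnorm2_has_ubound (B : {linear 'rV[R]_d -> 'M[R]_d}) :
  has_ubound [set r | exists u v,
    [/\ enorm u <= 1, enorm v <= 1 & r = enorm (v *m B u)]].
Proof.
exists (\sum_i \sum_k enorm (row k (B (delta_mx 0 i)))).
move=> _ /= [u [v [u1 v1 ->]]].
rewrite [u]row_sum_delta linear_sum mulmx_sumr.
rewrite (eq_bigr (fun i => u 0 i *: (v *m B (delta_mx 0 i)))); last first.
  by move=> i _; rewrite linearZ/= scalemxAr.
apply: le_trans (enorm_lincomb (fun i => v *m B (delta_mx 0 i)) u1) _.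
apply: ler_sum => i _; rewrite mulmx_sum_row.
exact: (enorm_lincomb (fun k => row k (B (delta_mx 0 i)))).
Qed.

Lemma enorm_le_opnorm2 (B : {linear 'rV[R]_d -> 'M[R]_d}) u v :
  enorm u <= 1 -> enorm v <= 1 -> enorm (v *m B u) <= opnorm2 B.
Proof.
by move=> u1 v1; apply: ub_le_sup; [exact: opnorm2_has_ubound|exists u, v].
Qed.

Lemma opnorm2N (B C : 'rV[R]_d -> 'M[R]_d) :
  (forall u, B u = - C u) -> opnorm2 B = opnorm2 C.
Proof.
move=> BC; congr sup; apply/seteqP; split=> _ /= [u [v [u1 v1 ->]]];
  by exists u, v; rewrite BC mulmxN enormN.
Qed.

Lemma opnorm2B (B C : {linear 'rV[R]_d -> 'M[R]_d}) :
  opnorm2 (B \- C) = opnorm2 (C \- B).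
Proof. by apply: opnorm2N => u /=; rewrite opprB. Qed.

Lemma opnorm20 (B : 'rV[R]_d -> 'M[R]_d) : (forall u, B u = 0) -> opnorm2 B = 0.
Proof.
move=> B0; rewrite /opnorm2 (_ : mkset _ = [set 0]) ?sup1//.
apply/seteqP; split=> [_ [u [v [_ _ ->]]]|_ ->] /=.
  by rewrite B0 mulmx0 enorm0.
by exists 0, 0; rewrite mul0mx enorm0.
Qed.

Lemma opnorm2D (B C D : {linear 'rV[R]_d -> 'M[R]_d}) :
  opnorm2 (B \- D) <= opnorm2 (B \- C) + opnorm2 (C \- D).
Proof.
apply: ge_sup => [|_ /= [u [v [u1 v1 ->]]]].
  by exists (enorm (0 *m (B \- D) 0)); exists 0, 0; rewrite enorm0.
have -> : B u - D u = (B \- C) u + (C \- D) u by rewrite /= addrA subrK.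
by rewrite mulmxDr (le_trans (enormD _ _))// lerD// enorm_le_opnorm2.
Qed.

End EuclideanNorm.

(* R^d with a point at infinity: [Some x] is x in R^d, [None] is infinity. *)
Notation rhat R d := (one_point_compactification 'rV[R]_d).

Section Mobius.
Context {R : realType} {d : nat}.

Definition similarity (l : R) (O : 'M[R]_d) (b : 'rV[R]_d) : rhat R d -> rhat R d :=
  omap (fun x => l *: (x *m O) + b).

Definition inversion (a : 'rV[R]_d) (r : R) (p : rhat R d) : rhat R d :=
  if p is Some x then
    if x == a then None
    else Some (a + (r ^+ 2 / enorm (x - a) ^+ 2) *: (x - a))
  else Some a.

Inductive mobius : (rhat R d -> rhat R d) -> Prop :=
| mobius_similarity l O b :
    0 < l -> O *m O^T = 1%:M -> mobius (similarity l O b)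
| mobius_inversion a r : 0 < r -> mobius (inversion a r)
| mobius_comp f g : mobius f -> mobius g -> mobius (f \o g).

Definition translation (c : 'rV[R]_d) : rhat R d -> rhat R d :=
  omap (fun x => x + c).

(* A self-map of R^d u {oo} read as a map into R^d; the value 0 is taken
   wherever the image is not in R^d. *)
Definition fpart (f : rhat R d -> rhat R d) (x : 'rV[R]_d) : 'rV[R]_d :=
  odflt 0 (f (Some x)).

(* Second derivative, as the differential of x |-> 'J f x. *)
Definition D2 (f : 'rV[R]_d -> 'rV[R]_d) (x : 'rV[R]_d) :
  {linear 'rV[R]_d -> 'M[R]_d} := 'd (jacobian f) x.

Definition grad (h : 'rV[R]_d -> R) (x : 'rV[R]_d) : 'rV[R]_d :=
  \row_j 'D_(delta_mx 0 j) h x.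

(* The continuous extension is unique since the points x with x and f x both
   in R^d are dense in R^d u {oo}. *)
Definition chordal_factor (f : rhat R d -> rhat R d) : rhat R d -> R :=
  get [set h : rhat R d -> R | [/\ continuous h, forall p, 0 < h p &
    forall x y, f (Some x) = Some y ->
      h (Some x) = opnorm ('J (fpart f) x) * ((1 + enorm x ^+ 2) / (1 + enorm y ^+ 2))]].

Definition domain (D : set 'rV[R]_d) := [/\ D !=set0, connected D & open D].

End Mobius.

Section SupNorm.
Context {R : realType} {T : Type} (A : set T).
Local Open Scope ereal_scope.

Definition supn (h : T -> R) : \bar R := ereal_sup [set (h x)%:E | x in A].

Lemma supn_triangle (f g h : T -> R) :
  (forall x, f x <= g x + h x)%R -> supn f <= supn g + supn h.
Proof.
move=> fgh; apply: ge_ereal_sup => _ [x Ax <-].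
apply: (@le_trans _ _ ((g x)%:E + (h x)%:E)); first by rewrite -EFinD lee_fin.
by apply: leeD; apply: ereal_sup_ubound; exists x.
Qed.

Lemma supn0_le (h : T -> R) : (forall x, h x = 0%R) -> supn h <= 0.
Proof. by move=> h0; apply: ge_ereal_sup => _ [x _ <-]; rewrite h0. Qed.

End SupNorm.

(* Conformal iterated function systems on Omega with extension domain Omega'. By
   Liouville's theorem a conformal map Omega' -> R^d is identified with the Mobius
   transformation that it is the restriction of. *)
Record cifs (R : realType) (d N : nat) (Omega Omega' : set 'rV[R]_d) := Cifs {
  cifs_map :> 'I_N -> rhat R d -> rhat R d;
  cifs_mobius : forall i, mobius (cifs_map i);
  cifs_finite : forall i x, Omega' x -> cifs_map i (Some x) <> None;
  cifs_self : forall i x, closure Omega x -> Omega (fpart (cifs_map i) x);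
  cifs_contract : forall i x, closure Omega x -> opnorm ('J (fpart (cifs_map i)) x) < 1 }.

Section Words.
Context {N : nat}.

Inductive word := Fin of seq 'I_N | Inf of (nat -> 'I_N).

(* [None] is the length of an infinite word. *)
Definition wlength (w : word) : option nat :=
  if w is Fin s then Some (size s) else None.

Definition wfirst (w : word) : option 'I_N :=
  match w with Fin s => ohead s | Inf w => Some (w 0%N) end.

Definition zpairs : set (word * word) :=
  [set ij | [/\ wlength ij.1 = wlength ij.2, wlength ij.1 <> Some 0%N &
                wfirst ij.1 <> wfirst ij.2]].

End Words.
Arguments word N : clear implicits.
Arguments zpairs N : clear implicits.

Section CIFS.
Context {R : realType} {d N : nat} {Omega Omega' : set 'rV[R]_d}.
Local Notation S := (cifs N Omega Omega').
Implicit Types Phi Psi : S.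

Definition c2dist (f g : 'rV[R]_d -> 'rV[R]_d) : \bar R :=
  (supn (closure Omega) (fun x => enorm (f x - g x)%R)
   + supn (closure Omega) (fun x => opnorm ('J f x - 'J g x)%R)
   + supn (closure Omega) (fun x => opnorm2 (D2 f x \- D2 g x)%R))%E.

Definition d2 Phi Psi : \bar R :=
  \big[maxe/-oo%E]_(i < N) c2dist (fpart (Phi i)) (fpart (Psi i)).

Definition lambda_max Phi : \bar R :=
  \big[maxe/-oo%E]_(i < N) supn (closure Omega) (fun x => opnorm ('J (fpart (Phi i)) x)).

Definition fword Phi (s : seq 'I_N) : rhat R d -> rhat R d :=
  foldl (fun f i => Phi i \o f) id s.

Definition Tfin Phi (s : seq 'I_N) : 'rV[R]_d -> 'rV[R]_d :=
  grad (fun x => ln (opnorm ('J (fpart (fword Phi s)) x))).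

(* The uniform limit on [closure Omega]; its values elsewhere are irrelevant. *)
Definition Tinf Phi (w : nat -> 'I_N) : 'rV[R]_d -> 'rV[R]_d :=
  get [set T | {uniform closure Omega, (fun n => Tfin Phi (mkseq w n)) @ \oo --> T}].

Definition Tword Phi (w : word N) : 'rV[R]_d -> 'rV[R]_d :=
  match w with Fin s => Tfin Phi s | Inf w => Tinf Phi w end.

Definition GT : set S := [set Phi |
  (0 < ereal_inf [set supn (closure Omega)
                        (fun x => enorm (Tword Phi ij.1 x - Tword Phi ij.2 x)%R)
                 | ij in zpairs N])%E].

Definition kappa (c : 'rV[R]_d) Phi : \bar R :=
  \big[maxe/-oo%E]_(i < N)
    supn setT (chordal_factor (translation (- c) \o Phi i \o translation c)).

Definition Uset : set S :=
  \bigcup_(c in [set: 'rV[R]_d]) [set Psi | (kappa c Psi < (N%:R `^ d%:R^-1)%:E)%E].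

Lemma c2dist_refl f : (c2dist f f <= 0)%E.
Proof.
rewrite /c2dist -[leRHS](addr0 0%E) -[X in (_ <= X + 0)%E](addr0 0%E).
apply: leeD; [apply: leeD|]; apply: supn0_le => x.
- by rewrite subrr enorm0.
- by rewrite subrr opnorm0.
- by rewrite opnorm20// => u /=; rewrite subrr.
Qed.

Lemma c2dist_sym f g : c2dist f g = c2dist g f.
Proof.
have E0 : (fun x => enorm (f x - g x)) = (fun x => enorm (g x - f x)).
  by apply/funext => x; rewrite -enormN opprB.
have E1 : (fun x => opnorm ('J f x - 'J g x)) = (fun x => opnorm ('J g x - 'J f x)).
  by apply/funext => x; exact: opnormB.
have E2 : (fun x => opnorm2 (D2 f x \- D2 g x)) = (fun x => opnorm2 (D2 g x \- D2 f x)).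
  by apply/funext => x; exact: opnorm2B.
exact: (congr2 adde (congr2 adde (congr1 (supn _) E0) (congr1 (supn _) E1))
                    (congr1 (supn _) E2)).
Qed.

Lemma c2dist_triangle f g h : (c2dist f h <= c2dist f g + c2dist g h)%E.
Proof.
rewrite /c2dist addeACA [X in (_ <= X + _)%E]addeACA.
apply: leeD; [apply: leeD|]; apply: supn_triangle => x.
- exact: enorm_distD.
- exact: opnorm_distD.
- exact: opnorm2D.
Qed.

Definition cifs_ball Phi (e : R) : set S := [set Psi | (d2 Phi Psi < e%:E)%E].

Lemma cifs_ball_center Phi (e : R) : 0 < e -> cifs_ball Phi e Phi.
Proof.
move=> e0; rewrite /cifs_ball/= (@le_lt_trans _ _ 0%E) ?lte_fin//.
by apply: bigmax_le => // i _; exact: c2dist_refl.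
Qed.

Lemma cifs_ball_sym Phi Psi (e : R) : cifs_ball Phi e Psi -> cifs_ball Psi e Phi.
Proof.
have E : d2 Phi Psi = d2 Psi Phi.
  by apply: eq_bigr => i _; exact: c2dist_sym.
by rewrite /cifs_ball/= -E.
Qed.

Lemma cifs_ball_triangle Phi Psi Xi (e1 e2 : R) :
  cifs_ball Phi e1 Psi -> cifs_ball Psi e2 Xi -> cifs_ball Phi (e1 + e2) Xi.
Proof.
rewrite /cifs_ball/= => h1 h2; rewrite EFinD; apply: le_lt_trans (lteD h1 h2).
apply: bigmax_le => [|i _]; first exact: leNye.
apply: le_trans (c2dist_triangle _ (fpart (Psi i)) _) _.
by apply: leeD; exact: le_bigmax.
Qed.

End CIFS.

(* (S, d_2) is equipped with the topology of the balls of [d2]. That d_2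
   separates points (two Mobius maps that agree on an open set are equal) is not
   part of the structure and does not affect the topology. *)
Section Topology.
Context {R : realType} {d N : nat} {Omega Omega' : set 'rV[R]_d}.
Local Notation S := (cifs N Omega Omega').

HB.instance Definition _ := gen_eqMixin S.
HB.instance Definition _ := gen_choiceMixin S.

Let ent : set_system (S * S) := entourage_ (@cifs_ball R d N Omega Omega').

HB.instance Definition _ := hasNbhs.Build S (nbhs_ ent).

HB.instance Definition _ := @Nbhs_isPseudoMetric.Build R S ent erefl
  (@cifs_ball R d N Omega Omega') (@cifs_ball_center R d N Omega Omega')
  (@cifs_ball_sym R d N Omega Omega') (@cifs_ball_triangle R d N Omega Omega') erefl.

End Topology.

(* Main.v *)
Require Import Defs.
From HB Require Import structures.
From mathcomp Require Import all_boot all_order all_algebra.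
From mathcomp Require Import all_classical all_reals all_analysis.
From mathcomp Require Import ring lra.
Set Implicit Arguments.
Unset Strict Implicit.
Unset Printing Implicit Defensive.
Import Order.TTheory GRing.Theory Num.Theory.
Import numFieldNormedType.Exports.
Local Open Scope classical_set_scope.
Local Open Scope ring_scope.

(* A Moebius map [f] is a similarity or [x |-> b + r (x - a) O / |x - a|^2] with [O]
   orthogonal, so [(1 + |f x|^2) / |Df x|] is the restriction of a quadratic polynomial
   [Q x = al |x|^2 + 2 <be, x> + ga] with [al ga - |be|^2 = 1], and the chordal factor
   is [(1 + |x|^2) / Q x]. As [Q] is determined by its values at finitely many points
   of [Omega], maps that are C^1-close on the closure of [Omega] have uniformly close
   chordal factors on the whole sphere, whence openness. By the discriminant relation
   the chordal factor is at least [1 / k] when it is at most [k]; at a point of the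
   closure of [Omega] nearest to [c] this gives [|D phi_i| >= 1 / k].

   [T_f] is [-2 (x - a) / |x - a|^2] or [0], and [T_(g o f) - T_(h o f)] at [x] has norm
   [|Df x|] times that of [T_g - T_h] at [f x]. If [Psi] belongs to [G_T] and its
   chordal factors are at most [k], then words of length [n] with distinct first
   letters have [T] uniformly separated, so any two of the [N^n] words of length [n]
   have [T] at distance at least [C / k^n] at a fixed point [x_0]. These vectors lie in
   a bounded part of R^d, so [N^n <= C' k^(n d)] for all [n], which is impossible when
   [k < N^(1/d)]. *)

(** * Normal form of Moebius maps *)

Section InnerProduct.
Context {R : realType} {d : nat}.
Implicit Types (u v w x y : 'rV[R]_d) (O : 'M[R]_d).

Definition dot u v : R := (u *m v^T) 0 0.

Lemma dotE u v : dot u v = \sum_j u 0 j * v 0 j.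
Proof. by rewrite /dot mxE; apply: eq_bigr => j _; rewrite mxE. Qed.

Lemma dotC u v : dot u v = dot v u.
Proof. by rewrite !dotE; apply: eq_bigr => j _; rewrite mulrC. Qed.

Lemma dotDl u v w : dot (u + v) w = dot u w + dot v w.
Proof. by rewrite /dot mulmxDl mxE. Qed.

Lemma dotZl a u w : dot (a *: u) w = a * dot u w.
Proof. by rewrite /dot -scalemxAl mxE. Qed.

Lemma dotDr u v w : dot w (u + v) = dot w u + dot w v.
Proof. by rewrite dotC dotDl !(dotC w). Qed.

Lemma dotZr a u w : dot w (a *: u) = a * dot w u.
Proof. by rewrite dotC dotZl (dotC w). Qed.

Lemma dotNl u w : dot (- u) w = - dot u w.
Proof. by rewrite -scaleN1r dotZl mulN1r. Qed.

Lemma dotNr u w : dot w (- u) = - dot w u.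
Proof. by rewrite dotC dotNl (dotC w). Qed.

Lemma dot0l w : dot 0 w = 0.
Proof. by rewrite /dot mul0mx mxE. Qed.

Lemma dot0r w : dot w 0 = 0.
Proof. by rewrite dotC dot0l. Qed.

Definition dotsE := (dotDl, dotDr, dotNl, dotNr, dotZl, dotZr, dot0l, dot0r).

Lemma dot_mulmx u v O : dot (u *m O) v = dot u (v *m O^T).
Proof. by rewrite /dot trmx_mul trmxK mulmxA. Qed.

Lemma enorm_sqrE u : enorm u ^+ 2 = dot u u.
Proof. by rewrite enorm_sqr dotE; apply: eq_bigr => j _; rewrite expr2. Qed.

Lemma dot_ge0 u : 0 <= dot u u.
Proof. by rewrite -enorm_sqrE sqr_ge0. Qed.

Lemma dot_eq0 u : (dot u u == 0) = (u == 0).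
Proof.
apply/eqP/eqP => [|->]; last by rewrite dot0l.
by move=> /eqP; rewrite -enorm_sqrE sqrf_eq0 => /eqP/enorm_eq0.
Qed.

Lemma dot_gt0 u : (0 < dot u u) = (u != 0).
Proof. by rewrite lt0r dot_ge0 andbT dot_eq0. Qed.

Lemma enormE u : enorm u = Num.sqrt (dot u u).
Proof. by rewrite -enorm_sqrE sqrtr_sqr ger0_norm// enorm_ge0. Qed.

Lemma dot_le_enorm u v : dot u v <= enorm u * enorm v.
Proof. by rewrite dotE enorm_dot. Qed.

Lemma dot_norm_le u v : `|dot u v| <= enorm u * enorm v.
Proof.
rewrite ler_norml dot_le_enorm andbT lerNl -dotNl -(enormN u).
exact: dot_le_enorm.
Qed.

Lemma enorm_gt0 u : (0 < enorm u) = (u != 0).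
Proof. by rewrite enormE sqrtr_gt0 dot_gt0. Qed.

Definition orth O := O *m O^T = 1%:M.

Lemma orth1 : orth 1%:M. Proof. by rewrite /orth trmx1 mulmx1. Qed.

Lemma orthM O P : orth O -> orth P -> orth (O *m P).
Proof. by rewrite /orth trmx_mul mulmxA -(mulmxA O) => h ->; rewrite mulmx1. Qed.

Lemma orth_tr O : orth O -> orth O^T.
Proof. by rewrite /orth trmxK; exact: mulmx1C. Qed.

Lemma dot_orth u v O : orth O -> dot (u *m O) (v *m O) = dot u v.
Proof. by move=> oO; rewrite dot_mulmx -mulmxA oO mulmx1. Qed.

Lemma enorm_orth u O : orth O -> enorm (u *m O) = enorm u.
Proof. by move=> oO; rewrite !enormE dot_orth. Qed.

(** The reflection in the hyperplane orthogonal to [u], acting on rows from the right. At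
    [u = x - a] it is the orthogonal part of the derivative at [x] of an inversion centred at
    [a]. *)
Definition refl u : 'M[R]_d := 1%:M - (2 / dot u u) *: (u^T *m u).

Lemma mul_refl v u : v *m refl u = v - (2 * dot v u / dot u u) *: u.
Proof.
rewrite /refl mulmxBr mulmx1 -scalemxAr mulmxA; congr (_ - _).
rewrite [v *m u^T]mx11_scalar mul_scalar_mx scalerA; congr (_ *: _).
by rewrite /dot mulrAC.
Qed.

Lemma refl_tr u : (refl u)^T = refl u.
Proof. by rewrite /refl linearB linearZ/= trmx1 trmx_mul trmxK. Qed.

Lemma orth_refl u : u != 0 -> orth (refl u).
Proof.
rewrite -dot_eq0 => u0; rewrite /orth refl_tr; apply/row_matrixP => i.
rewrite row1 rowE mulmxA !mul_refl !dotsE; move: (delta_mx 0 i) => e.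
apply/rowP => j; rewrite !mxE; field.
by rewrite u0.
Qed.

Lemma row_ne0 : (0 < d)%N -> exists e : 'rV[R]_d, dot e e = 1.
Proof.
move=> d0; exists (delta_mx 0 (Ordinal d0)).
by rewrite /dot trmx_delta mul_delta_mx mxE !eqxx.
Qed.

End InnerProduct.

(** * Moebius maps as similarities or as inversions followed by isometries *)

Section NormalForm.
Context {R : realType} {d : nat}.
Implicit Types (a b u v w x y : 'rV[R]_d) (O : 'M[R]_d) (l r : R).

Let eq_addl b v : (b + v == b) = (v == 0).
Proof. by rewrite -subr_eq0 addrAC subrr add0r. Qed.

(** The general Moebius map with a finite pole: [a] is the pole, [b] the image of infinity and [r]
    the squared radius of the inversion. *)
Definition iform a b r O (p : rhat R d) : rhat R d :=
  if p is Some x then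
    if x == a then None
    else Some (b + (r / dot (x - a) (x - a)) *: ((x - a) *m O))
  else Some b.

Lemma inversionE a r : inversion a r = iform a a (r ^+ 2) 1%:M.
Proof. by apply/funext => -[x|//]; rewrite /= mulmx1 enorm_sqrE. Qed.

Lemma similarity_iform l O b a b' r O' : 0 < l -> orth O ->
  similarity l O b \o iform a b' r O' =
  iform a (l *: (b' *m O) + b) (l * r) (O' *m O).
Proof.
move=> l0 oO; apply/funext => -[x|//] /=; case: ifP => //= xa; congr Some.
rewrite mulmxDl -scalemxAl mulmxA.
by apply/rowP => j; rewrite !mxE; ring.
Qed.

Lemma iform_similarity l O b a b' r O' : 0 < l -> orth O ->
  iform a b' r O' \o similarity l O b =
  iform (l^-1 *: ((a - b) *m O^T)) b' (r / l) (O *m O').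
Proof.
move=> l0 oO; apply/funext => -[x|//] /=.
set a' := l^-1 *: _.
have E : l *: (x *m O) + b - a = l *: ((x - a') *m O).
  rewrite mulmxBl -scalemxAl -mulmxA (mulmx1C oO) mulmx1.
  by apply/rowP => j; rewrite !mxE; field; rewrite gt_eqF.
have E1 : (l *: (x *m O) + b == a) = (x == a').
  rewrite -subr_eq0 E scaler_eq0 gt_eqF//= -[RHS]subr_eq0.
  by rewrite -dot_eq0 dot_orth// dot_eq0.
rewrite E1; case: ifPn => //= xa; congr Some.
rewrite E dotZl dotZr dot_orth// -scalemxAl -mulmxA.
apply/rowP => j; rewrite !mxE; field.
by rewrite dot_eq0 subr_eq0 xa gt_eqF.
Qed.

(** The inner map sends infinity to the pole of the outer one, so the composition fixes infinity and
    the two inversions cancel up to the scale [r' / r]. *)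
Lemma iform_iform_pole a b r O b' r' O' : 0 < r -> orth O -> 0 < r' ->
  iform b b' r' O' \o iform a b r O =
  similarity (r' / r) (O *m O') (b' - (r' / r) *: (a *m (O *m O'))).
Proof.
move=> r0 oO r'0; apply/funext => -[x|] /=; last by rewrite eqxx.
have [->|xa] := eqVneq x a; first by congr Some; rewrite addrC subrK.
have s0 : dot (x - a) (x - a) != 0 by rewrite dot_eq0 subr_eq0.
rewrite /= eq_addl scaler_eq0 mulf_eq0 invr_eq0 (negbTE s0) gt_eqF//=.
rewrite -dot_eq0 dot_orth// (negbTE s0); congr Some.
rewrite (addrC b) addrK dotZl dotZr dot_orth// -scalemxAl -mulmxA mulmxBl.
apply/rowP => j; rewrite !mxE; field.
by rewrite s0 gt_eqF.
Qed.

(** The new pole is the preimage [a + u] of [a']. With [y = x - a], the vector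
    [y / |y|^2 - u / |u|^2] has norm [|y - u| / (|y| |u|)], and inverting it at the origin gives
    [-u] plus [|u|^2 / |y - u|^2] times the image of [y - u] under [refl u]. *)
Lemma iform_iform a b r O a' b' r' O' :
  0 < r -> orth O -> 0 < r' -> orth O' -> b != a' ->
  exists a2 b2 r2 O2, [/\ 0 < r2, orth O2 &
    iform a' b' r' O' \o iform a b r O = iform a2 b2 r2 O2].
Proof.
move=> r0 oO r'0 oO' ba'.
set w := (b - a') *m O^T.
have w0 : dot w w != 0.
  by rewrite dot_orth; [rewrite dot_eq0 subr_eq0|exact: orth_tr].
(* The vector [u] solves [r u / |u|^2 = -w], which says that the inner map sends [a + u] to [a']. *)
have [u [u0 wu]] : exists u, dot u u != 0 /\ w = - (r / dot u u) *: u.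
  exists (- (r / dot w w) *: w); rewrite !dotZl !dotZr; split.
    by rewrite !mulf_eq0 oppr_eq0 !mulf_eq0 invr_eq0 (negbTE w0) gt_eqF.
  apply/rowP => j; rewrite !mxE; field.
  by rewrite w0 gt_eqF.
have bw : b - a' = w *m O by rewrite /w -mulmxA (mulmx1C oO) mulmx1.
pose M := O *m O'.
exists (a + u), (b' - (r' / r) *: (u *m M)), (r' / r * dot u u), (refl u *m M).
split.
- by rewrite mulr_gt0 ?divr_gt0// lt0r u0 dot_ge0.
- by apply: orthM; [apply: orth_refl; rewrite -dot_eq0|exact: orthM].
apply/funext => -[x|] /=; last first.
  have ww : dot w w = r ^+ 2 / dot u u by rewrite wu dotZl dotZr; field.
  rewrite (negbTE ba') bw dot_orth// -mulmxA -/M ww wu; congr Some.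
  rewrite -scalemxAl; apply/rowP => j; rewrite !mxE; field.
  by rewrite u0 gt_eqF.
have [->|xa] := eqVneq x a.
  rewrite [a == _]eq_sym eq_addl -dot_eq0 (negbTE u0).
  congr Some; have -> : a - (a + u) = - u by rewrite opprD addrA subrr sub0r.
  rewrite mulmxA mul_refl !dotsE.
  rewrite mulmxBl -scalemxAl mulNmx.
  by apply/rowP => j; rewrite !mxE; field; rewrite u0 gt_eqF.
have y0 : dot (x - a) (x - a) != 0 by rewrite dot_eq0 subr_eq0.
have xau : x - (a + u) = x - a - u by rewrite opprD addrA.
move: (x - a) y0 xau => y y0 xau.
have E : b + (r / dot y y) *: (y *m O) - a' = r *: (((dot y y)^-1 *: y - (dot u u)^-1 *: u) *m O).
  rewrite addrAC bw wu mulmxBl -!scalemxAl.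
  by apply/rowP => j; rewrite !mxE; field; rewrite y0 u0.
have E2 : dot ((dot y y)^-1 *: y - (dot u u)^-1 *: u) ((dot y y)^-1 *: y - (dot u u)^-1 *: u) =
   dot (y - u) (y - u) / (dot y y * dot u u).
  by rewrite !dotsE (dotC u y); field; rewrite y0 u0.
rewrite /= -(subr_eq0 _ a') E scaler_eq0 gt_eqF//= -dot_eq0 dot_orth// E2.
rewrite mulf_eq0 invr_eq0 mulf_eq0 (negbTE y0) (negbTE u0) !orbF.
rewrite -(subr_eq0 x) xau dot_eq0; case: ifPn => //; rewrite -dot_eq0 => yu.
congr Some; rewrite dotZl dotZr dot_orth// E2 -scalemxAl -mulmxA -/M.
rewrite mulmxA mul_refl !mulmxBl -!scalemxAl.
(* Polarization leaves an identity that is rational in the three squared norms and the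
   coordinates. *)
have uyy : dot (y - u) u = (dot y y - dot (y-u) (y-u) - dot u u) / 2.
  by rewrite !dotsE (dotC u y); field.
rewrite uyy.
move: (dot (y - u) (y - u)) yu => q q0.
apply/rowP => j; rewrite !mxE; field.
by rewrite q0 y0 u0 gt_eqF.
Qed.

Variant normal_form (f : rhat R d -> rhat R d) : Prop :=
| NFsim l O b : 0 < l -> orth O -> f = similarity l O b -> normal_form f
| NFinv a b r O : 0 < r -> orth O -> f = iform a b r O -> normal_form f.

Lemma mobius_normal f : mobius f -> normal_form f.
Proof.
elim=> [l O b l0 oO|a r r0|g h _ IHg _ IHh].
- by apply: NFsim erefl.
- by apply: (@NFinv _ a a (r ^+ 2) 1%:M); [exact: exprn_gt0|exact: orth1|exact: inversionE].
- case: IHg => [l O b l0 oO ->|a b r O r0 oO ->];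
  case: IHh => [l' O' b' l'0 oO' ->|a' b' r' O' r'0 oO' ->].
  + apply: (@NFsim _ (l * l') (O' *m O) (l *: (b' *m O) + b)).
    * exact: mulr_gt0.
    * exact: orthM.
    * apply/funext => -[x|//] /=; congr Some.
      rewrite mulmxDl -scalemxAl mulmxA.
      by apply/rowP => j; rewrite !mxE; ring.
  + rewrite similarity_iform//.
    by apply: NFinv erefl; [exact: mulr_gt0|exact: orthM].
  + rewrite iform_similarity//.
    by apply: NFinv erefl; [exact: divr_gt0|exact: orthM].
  + have [<-|ba] := eqVneq b' a.
      rewrite iform_iform_pole//.
      by apply: NFsim erefl; [exact: divr_gt0|exact: orthM].
    have [a2 [b2 [r2 [P [r20 oP E]]]]] := iform_iform a' b r'0 oO' r0 oO ba.
    exact: NFinv E.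
Qed.

End NormalForm.

(** * Conformal derivatives *)

(** A differential depends only on the germ, so [fpart] can be differentiated through formulas that
    hold only away from a pole. *)
Lemma is_diff_near (R : numFieldType) (V W : normedModType R) (f g dg : V -> W) (x : V) :
  (\near x, f x = g x) -> is_diff x g dg -> is_diff x f dg.
Proof.
move=> fg [gd gv].
have fgx : f x = g x := nbhs_singleton fg.
have E : f \o shift x = cst (f x) + 'd g x +o_ 0 id.
  have /eqaddoP H := diff_locally gd.
  apply/eqaddoP => e e0; have := H e e0.
  have : \forall h \near 0, f (h + x) = g (h + x).
    by move: fg; rewrite (near_shift 0) subr0.
  by apply: filterS2 => h fgh; rewrite !fctE /= fgh fgx.
have D := diff_unique (diff_continuous gd) E.
apply: DiffDef; last by rewrite D.
by apply/diff_locallyP; rewrite D; split => //; exact: diff_continuous.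
Qed.

Section Differentials.
Context {R : realType} {d : nat}.
Local Notation V := 'rV[R]_d.
Implicit Types (a b u v w x y : V) (O : 'M[R]_d) (l r : R).

Lemma mulmxr_continuous O : continuous (fun x : V => x *m O).
Proof.
rewrite (_ : (fun y : V => _) = (fun y => \sum_i y 0 i *: row i O)); last first.
  by apply/funext => y; rewrite mulmx_sum_row.
apply: continuous_big => [|i _ x]; first exact: add_continuous.
by apply: cvgZr_tmp; [exact: nbhs_filter|exact: coord_continuous].
Qed.

Lemma dot_continuous : continuous (fun p : V * V => dot p.1 p.2).
Proof.
rewrite (_ : (fun p : V * V => _) = (fun p => \sum_j p.1 0 j * p.2 0 j)); last first.
  by apply/funext => p; rewrite dotE.
apply: continuous_big => [|i _ x]; first exact: add_continuous.
apply: continuousM; apply: (@continuous_comp _ _ _ _ (fun v : V => v 0 i)).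
- exact: cvg_fst.
- exact: coord_continuous.
- exact: cvg_snd.
- exact: coord_continuous.
Qed.

Lemma dot_is_bilinear : bilinear_for
  (GRing.Scale.Law.clone _ _ *:%R _) (GRing.Scale.Law.clone _ _ *:%R _)
  (@dot R d).
Proof. by split=> [u'|u] a x y /=; rewrite !dotsE. Qed.

HB.instance Definition _ := bilinear_isBilinear.Build R V V R _ _ (@dot R d)
  dot_is_bilinear.

Lemma scale_is_bilinear : bilinear_for
  (GRing.Scale.Law.clone _ _ *:%R _) (GRing.Scale.Law.clone _ _ *:%R _)
  (@GRing.scale R V : R -> V -> V).
Proof.
split=> [u'|u] a x y /=; first by rewrite scalerDl scalerA.
by rewrite scalerDr !scalerA mulrC.
Qed.

HB.instance Definition _ := bilinear_isBilinear.Build R R V V _ _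
  (@GRing.scale R V : R -> V -> V) scale_is_bilinear.

Lemma scale_continuous_pair : continuous (fun p : R * V => p.1 *: p.2).
Proof. by move=> p; apply: cvgZ; [exact: cvg_fst|exact: cvg_snd]. Qed.

Lemma is_diff_mulmxr O x : is_diff x (fun y : V => y *m O) (fun y => y *m O).
Proof.
apply: DiffDef; first exact: (linear_differentiable (f := mulmxr O) _ (@mulmxr_continuous O)).
exact: (diff_lin (f := mulmxr O) _ (@mulmxr_continuous O)).
Qed.

Lemma is_diff_dot (p : V * V) :
  is_diff p (fun q : V * V => dot q.1 q.2) (fun q => dot p.1 q.2 + dot q.1 p.2).
Proof.
apply: DiffDef; first exact: (differentiable_bilin (f := @dot R d) _ dot_continuous).
exact: (diff_bilin (f := @dot R d) _ dot_continuous).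
Qed.

Lemma is_diff_scale (U : normedModType R) (k dk : U -> R) (f df : U -> V) (z : U) :
  is_diff z k dk -> is_diff z f df ->
  is_diff z (fun t => k t *: f t) (fun t => k z *: df t + dk t *: f z).
Proof.
move=> dk' df'.
have H (p : (R * V)%type) : is_diff p (fun q : R * V => q.1 *: q.2) (fun q => p.1 *: q.2 + q.1 *: p.2).
  apply: DiffDef.
    exact: (differentiable_bilin (f := (@GRing.scale R V : R -> V -> V)) _ scale_continuous_pair).
  exact: (diff_bilin (f := (@GRing.scale R V : R -> V -> V)) _ scale_continuous_pair).
exact: (@is_diff_comp _ _ _ _ (fun t => (k t, f t)) _ (fun q : R * V => q.1 *: q.2)).
Qed.

Lemma is_diff_sqdist a x :
  is_diff x (fun y => dot (y - a) (y - a)) (fun v => 2 * dot (x - a) v).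
Proof.
have H0 : is_diff x (fun y : V => y - a) (fun v => v).
  have H : is_diff x (fun y : V => y - a) (id - (0 : V -> V)) by exact: is_diffB.
  by apply: is_diff_eq H _; apply/funext => v; rewrite !fctE subr0.
have H1 : is_diff x (fun y : V => (y - a, y - a)) (fun v => (v, v)) by exact: is_diff_pair.
have H2 := is_diff_dot (x - a, x - a).
have := is_diff_comp H1 H2; move/is_diff_eq; apply => /=.
by apply/funext => v /=; rewrite (dotC v); ring.
Qed.

Lemma is_diff_inv (f df : V -> R) x : f x != 0 -> is_diff x f df ->
  is_diff x (fun y => (f y)^-1) (fun v => - (f x) ^- 2 * df v).
Proof.
move=> fx0 [fd fv]; apply: DiffDef; first exact: differentiableV.
by rewrite diffV// fv.
Qed.

Lemma is_diff_stretch a r x : x != a ->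
  is_diff x (fun y => r / dot (y - a) (y - a))
    (fun v => - (r / dot (x - a) (x - a) ^+ 2) * (2 * dot (x - a) v)).
Proof.
move=> xa; have x0 : dot (x - a) (x - a) != 0 by rewrite dot_eq0 subr_eq0.
have := is_diffZ r (is_diff_inv (f := fun y => dot (y - a) (y - a)) x0 (is_diff_sqdist a x)).
by move/is_diff_eq; apply; apply/funext => v; rewrite !fctE /= /GRing.scale/=; ring.
Qed.

(** Before [O] and the scaling, the product rule yields [v - 2 <x - a, v> / |x - a|^2 (x - a)],
    which is [v *m refl (x - a)]. *)
Lemma is_diff_iform a b r O x : x != a ->
  is_diff x (fun y => b + (r / dot (y - a) (y - a)) *: ((y - a) *m O))
    (fun v => (r / dot (x - a) (x - a)) *: (v *m refl (x - a) *m O)).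
Proof.
move=> xa; have x0 : dot (x - a) (x - a) != 0 by rewrite dot_eq0 subr_eq0.
have H1 : is_diff x (fun y : V => (y - a) *m O) (fun v => v *m O).
  have := is_diffB (is_diff_mulmxr O x) (is_diff_cst (a *m O) x).
  rewrite (_ : _ - cst _ = fun y : V => (y - a) *m O); last first.
    by apply/funext => y; rewrite !fctE mulmxBl.
  by move/is_diff_eq; apply; apply/funext => v; rewrite !fctE subr0.
have := is_diffD (is_diff_cst b x) (is_diff_scale (is_diff_stretch r xa) H1).
move/is_diff_eq; apply; apply/funext => v; rewrite !fctE add0r mul_refl.
rewrite [(v - _) *m O]mulmxBl -scalemxAl; apply/rowP => j; rewrite !mxE (dotC v); field.
by rewrite x0.
Qed.

Lemma is_diff_similarity l O b x :
  is_diff x (fun y => l *: (y *m O) + b) (fun v => l *: (v *m O)).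
Proof.
have := is_diffD (is_diffZ l (is_diff_mulmxr O x)) (is_diff_cst b x).
by move/is_diff_eq; apply; apply/funext => v; rewrite !fctE addr0.
Qed.

End Differentials.

Lemma is_diff_ln (R : realType) (t : R) : 0 < t -> is_diff t (@ln R) (fun v => t^-1 * v).
Proof.
move=> t0; have [dl lv] := is_derive1_ln t0.
apply: DiffDef; first exact/derivable1_diffP.
rewrite diff1E; last exact/derivable1_diffP.
by rewrite derive1E lv; apply/funext => v; rewrite /= mulrC.
Qed.

(** * The stretch of a Moebius map and the gradient of its logarithm *)

Fact stretch_key : unit. Proof. by []. Qed.

Section Stretch.
Context {R : realType} {d : nat}.
Local Notation V := 'rV[R]_d.
Implicit Types (a b u v w x y : V) (O : 'M[R]_d) (l r : R).
Implicit Types (f g : rhat R d -> rhat R d).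

Lemma jacobian_is_diff (F : V -> V) (A : 'M[R]_d) x :
  is_diff x F (fun v => v *m A) -> 'J F x = A.
Proof.
move=> [_ E]; apply/row_matrixP => i; rewrite !rowE /jacobian mul_rV_lin1.
by rewrite E.
Qed.

Lemma grad_is_diff (h : V -> R) w x :
  is_diff x h (fun v => dot v w) -> grad h x = w.
Proof.
move=> [hd E]; apply/rowP => j; rewrite mxE deriveE// E dotE (bigD1 j)//= mxE !eqxx mul1r.
by rewrite big1 ?addr0// => i ij; rewrite mxE (negbTE ij) andbF mul0r.
Qed.

(* Locked, for otherwise comparing two stretches unfolds them down to limits. *)
Definition stretch f x : R := locked_with stretch_key (opnorm ('J (fpart f) x)).

Lemma stretchE f x : stretch f x = opnorm ('J (fpart f) x).
Proof. exact: locked_withE. Qed.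

Definition logder f x : V := locked_with stretch_key (grad (fun y => ln (stretch f y)) x).

Lemma logderE f : logder f = grad (fun x => ln (stretch f x)).
Proof. by apply/funext => x; exact: locked_withE. Qed.

Lemma neq_near a x : x != a -> \forall z \near x, z != a.
Proof.
move=> xa; have : nbhs x (~` [set a]).
  apply: open_nbhs_nbhs; split; last exact/eqP.
  exact/closed_openC/accessible_closed_set1/hausdorff_accessible/norm_hausdorff.
by apply: filterS => z /eqP.
Qed.

Lemma finite_near f x y : normal_form f -> f (Some x) = Some y ->
  \forall z \near x, f (Some z) = Some (fpart f z).
Proof.
case=> [l O b l0 oO -> _|a b r O r0 oO ->] /=; first by near=> z.
case: ifPn => // xa _.
by apply: filterS (neq_near xa) => z za; rewrite /fpart /= (negbTE za).
Unshelve. all: by end_near. Qed.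

Lemma is_diff_fpart_similarity l O b x :
  is_diff x (fpart (similarity l O b)) (fun v => v *m (l *: O)).
Proof.
have := is_diff_similarity l O b x; move/is_diff_eq; apply.
by apply/funext => v; rewrite scalemxAr.
Qed.

Lemma is_diff_fpart_iform a b r O x : x != a ->
  is_diff x (fpart (iform a b r O))
    (fun v => v *m ((r / dot (x - a) (x - a)) *: (refl (x - a) *m O))).
Proof.
move=> xa; apply: is_diff_near; last first.
  have := is_diff_iform b r O xa; move/is_diff_eq; apply.
  by apply/funext => v; rewrite -[RHS]scalemxAr mulmxA.
by apply: filterS (neq_near xa) => z za; rewrite /fpart /= (negbTE za).
Qed.

Section PositiveDim.
Hypothesis d0 : (0 < d)%N.

Lemma opnorm_conformal l O : 0 <= l -> orth O -> opnorm (l *: O) = l.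
Proof.
move=> l0 oO; have E v : enorm (v *m (l *: O)) = l * enorm v.
  by rewrite -scalemxAr enormZ enorm_orth// ger0_norm.
apply/eqP; rewrite eq_le; apply/andP; split.
  apply: ge_sup => [|_ [v /= v1 <-]]; first by exists (enorm (0 *m (l *: O))), 0; rewrite /= ?enorm0.
  by rewrite E ler_piMr.
have [e e1] := @row_ne0 R d d0.
have e2 : enorm e = 1 by rewrite enormE e1 sqrtr1.
by rewrite -[leLHS]mulr1 -e2 -E enorm_le_opnorm// e2.
Qed.

Lemma stretch_similarity l O b x : 0 < l -> orth O -> stretch (similarity l O b) x = l.
Proof.
move=> l0 oO; rewrite stretchE (jacobian_is_diff (is_diff_fpart_similarity l O b x)).
by rewrite opnorm_conformal// ltW.
Qed.

Lemma stretch_iform a b r O x : 0 < r -> orth O -> x != a ->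
  stretch (iform a b r O) x = r / dot (x - a) (x - a).
Proof.
move=> r0 oO xa; rewrite stretchE (jacobian_is_diff (is_diff_fpart_iform b r O xa)).
rewrite opnorm_conformal//; first by rewrite divr_ge0 ?dot_ge0 ?ltW.
by apply: orthM => //; apply: orth_refl; rewrite subr_eq0.
Qed.

(** Conformality in coordinates. It makes operator norms multiply under composition, and lets the
    transposed derivative scale lengths exactly. *)
Lemma fpart_conformal f x y : normal_form f -> f (Some x) = Some y ->
  exists P, [/\ orth P, 0 < stretch f x &
    is_diff x (fpart f) (fun v => v *m (stretch f x *: P))].
Proof.
case=> [l O b l0 oO -> _|a b r O r0 oO ->] /=.
  exists O; rewrite (stretch_similarity b x l0 oO); split; [by []|by []|].
  exact: is_diff_fpart_similarity.
case: ifPn => // xa _; exists (refl (x - a) *m O).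
rewrite (stretch_iform b r0 oO xa); split.
- by apply: orthM => //; apply: orth_refl; rewrite subr_eq0.
- by rewrite divr_gt0// dot_gt0 subr_eq0.
- exact: is_diff_fpart_iform.
Qed.

Lemma is_diff_log_similarity l O b x : 0 < l -> orth O ->
  is_diff x (fun z => ln (stretch (similarity l O b) z)) (fun v => dot v 0).
Proof.
move=> l0 oO; have := is_diff_cst (ln l) x.
rewrite (_ : cst _ = fun z => ln (stretch (similarity l O b) z)); last first.
  by apply/funext => z; rewrite stretch_similarity.
by move/is_diff_eq; apply; apply/funext => v; rewrite dot0r.
Qed.

Lemma is_diff_log_iform a b r O x : 0 < r -> orth O -> x != a ->
  is_diff x (fun z => ln (stretch (iform a b r O) z))
    (fun v => dot v (- (2 / dot (x - a) (x - a)) *: (x - a))).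
Proof.
move=> r0 oO xa; have xa0 : 0 < dot (x - a) (x - a) by rewrite dot_gt0 subr_eq0.
have H := is_diff_comp (is_diff_stretch r xa) (is_diff_ln (divr_gt0 r0 xa0)).
apply: is_diff_near; last first.
  move: H; move/is_diff_eq; apply; apply/funext => v /=.
  by rewrite dotZr (dotC v); field; rewrite !gt_eqF.
by apply: filterS (neq_near xa) => z za; rewrite stretch_iform.
Qed.

Lemma logder_similarity l O b x : 0 < l -> orth O -> logder (similarity l O b) x = 0.
Proof. by move=> l0 oO; rewrite logderE; apply: grad_is_diff; exact: is_diff_log_similarity. Qed.

(** The logarithm of the stretch is a constant minus [ln |x - a|^2], so the gradient depends on the
    pole alone. *)
Lemma logder_iform a b r O x : 0 < r -> orth O -> x != a ->
  logder (iform a b r O) x = - (2 / dot (x - a) (x - a)) *: (x - a).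
Proof. by move=> r0 oO xa; rewrite logderE; apply: grad_is_diff; exact: is_diff_log_iform. Qed.

Lemma is_diff_log f x y : normal_form f -> f (Some x) = Some y ->
  is_diff x (fun z => ln (stretch f z)) (fun v => dot v (logder f x)).
Proof.
case=> [l O b l0 oO -> _|a b r O r0 oO ->] /=.
  by rewrite logder_similarity//; exact: is_diff_log_similarity.
by case: ifPn => // xa _; rewrite logder_iform//; exact: is_diff_log_iform.
Qed.

Lemma fpart_finite f x y : f (Some x) = Some y -> fpart f x = y.
Proof. by rewrite /fpart => ->. Qed.

Lemma is_diff_fpart_comp f g x y (A B : 'M[R]_d) :
  normal_form f -> f (Some x) = Some y ->
  is_diff x (fpart f) (fun v => v *m A) -> is_diff y (fpart g) (fun v => v *m B) ->
  is_diff x (fpart (g \o f)) (fun v => v *m (A *m B)).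
Proof.
move=> nf fx fA gB; rewrite -(fpart_finite fx) in gB.
have := is_diff_comp fA gB => H.
apply: is_diff_near; last first.
  by move: H; move/is_diff_eq; apply; apply/funext => v /=; rewrite mulmxA.
by apply: filterS (finite_near nf fx) => t E; rewrite /= {1}/fpart /= E.
Qed.

Lemma stretch_comp f g x y z : normal_form f -> normal_form g ->
  f (Some x) = Some y -> g (Some y) = Some z ->
  stretch (g \o f) x = stretch g y * stretch f x.
Proof.
move=> nf ng fx gy.
have [P [oP s0 dP]] := fpart_conformal nf fx.
have [Q [oQ t0 dQ]] := fpart_conformal ng gy.
have D := is_diff_fpart_comp nf fx dP dQ.
rewrite [LHS]stretchE (jacobian_is_diff D).
have mulZZ (s t : R) : (s *: P) *m (t *: Q) = (t * s) *: (P *m Q).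
  by rewrite -scalemxAl -scalemxAr scalerA (mulrC s).
rewrite mulZZ.
apply: opnorm_conformal; last exact: orthM.
exact: mulr_ge0 (ltW t0) (ltW s0).
Qed.

(** This is the gradient of [ln |Df| + ln |Dg| o f]. The Jacobian is transposed because a gradient
    represents a functional through [dot]. *)
Lemma logder_comp f g x y z : normal_form f -> normal_form g ->
  f (Some x) = Some y -> g (Some y) = Some z ->
  logder (g \o f) x = logder f x + logder g y *m ('J (fpart f) x)^T.
Proof.
move=> nf ng fx gy.
have [P [oP s0 dP]] := fpart_conformal nf fx.
rewrite (jacobian_is_diff dP) [logder (g \o f)]logderE; apply: grad_is_diff.
have Lf := is_diff_log nf fx.
have Lg := is_diff_log ng gy.
rewrite -(fpart_finite fx) in Lg.
have := is_diffD Lf (is_diff_comp dP Lg) => H.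
apply: is_diff_near; last first.
  move: H; move/is_diff_eq; apply; apply/funext => v.
  by rewrite fctE /= dotDr (fpart_finite fx) dot_mulmx.
have near_g : \forall t \near x, g (Some (fpart f t)) = Some (fpart g (fpart f t)).
  have [fd _] := dP.
  have gy' : g (Some (fpart f x)) = Some z by rewrite (fpart_finite fx).
  exact: differentiable_continuous fd _ (finite_near ng gy').
apply: filterS2 (finite_near nf fx) near_g => t ft gt.
have [? [_ st _]] := fpart_conformal nf ft.
have [? [_ st' _]] := fpart_conformal ng gt.
rewrite (stretch_comp nf ng ft gt) lnM; [exact: addrC|exact: st'|exact: st].
Qed.

(** The terms of [f] cancel, and the transposed derivative of [f] is an isometry times
    [stretch f x]. *)
Lemma logder_compB f g h x y z t : normal_form f -> normal_form g -> normal_form h ->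
  f (Some x) = Some y -> g (Some y) = Some z -> h (Some y) = Some t ->
  enorm (logder (g \o f) x - logder (h \o f) x) =
  stretch f x * enorm (logder g y - logder h y).
Proof.
move=> nf ng nh fx gy hy.
rewrite (logder_comp nf ng fx gy) (logder_comp nf nh fx hy).
have [P [oP s0 dP]] := fpart_conformal nf fx.
rewrite (jacobian_is_diff dP); move: (stretch f x) s0 => s s0.
have vecE p q q' : enorm (p + q *m (s *: P)^T - (p + q' *m (s *: P)^T)) = s * enorm (q - q').
  rewrite opprD addrACA subrr add0r -mulmxBl linearZ/= -scalemxAr enormZ gtr0_norm//.
  by rewrite enorm_orth//; exact: orth_tr.
exact: vecE.
Qed.

End PositiveDim.
End Stretch.

(** * Chordal factors as ratios of quadratic polynomials *)

Section PointwiseContinuity.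
Context {R : realType} {T : topologicalType}.
Implicit Types (f g : T -> R) (x : T).

Lemma cont_cst (k : R) x : {for x, continuous (fun _ => k)}.
Proof. exact: cst_continuous. Qed.

Lemma contD f g x : {for x, continuous f} -> {for x, continuous g} ->
  {for x, continuous (fun z => f z + g z)}.
Proof. exact: continuousD. Qed.

Lemma contB f g x : {for x, continuous f} -> {for x, continuous g} ->
  {for x, continuous (fun z => f z - g z)}.
Proof. exact: continuousB. Qed.

Lemma contM f g x : {for x, continuous f} -> {for x, continuous g} ->
  {for x, continuous (fun z => f z * g z)}.
Proof. exact: continuousM. Qed.

Lemma cont_normr f x : {for x, continuous f} -> {for x, continuous (fun z => `|f z|)}.
Proof. by move=> fx; apply: continuous_comp fx _; exact: norm_continuous. Qed.

End PointwiseContinuity.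

Section Quadratic.
Context {R : realType} {d : nat}.
Local Notation V := 'rV[R]_d.
Implicit Types (a b u v w x y be c : V) (O : 'M[R]_d) (l r al ga : R).
Implicit Types (f g : rhat R d -> rhat R d).

Lemma norm_le_enorm x : `|x| <= enorm x.
Proof.
rewrite /Num.norm/= mx_normrE; apply: bigmax_le; first exact: enorm_ge0.
by move=> [i j] _ /=; rewrite ord1 coord_le_enorm.
Qed.

Lemma enorm_le_norm x : enorm x <= d%:R * `|x|.
Proof.
rewrite [x]row_sum_delta; apply: le_trans (enorm_sum _) _.
rewrite -row_sum_delta.
apply: le_trans (_ : \sum_(i < d) `|x| <= _); last by rewrite sumr_const card_ord mulr_natl.
apply: ler_sum => i _; rewrite enormZ.
have -> : enorm (delta_mx 0 i : V) = 1.
  by rewrite enormE /dot trmx_delta mul_delta_mx mxE !eqxx sqrtr1.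
rewrite mulr1 [leRHS]/Num.norm/= mx_normrE.
by apply: (@le_bigmax _ _ _ 0 (fun k : 'I_1 * 'I_d => `|x k.1 k.2|) (0, i)).
Qed.

Definition quad al be ga x := al * dot x x + 2 * dot be x + ga.

(** Completing the square: the relation between the coefficients leaves the constant 1. *)
Lemma quad_sqr al be ga x : al * ga = 1 + dot be be ->
  al * quad al be ga x = dot (al *: x + be) (al *: x + be) + 1.
Proof.
move=> h; rewrite /quad !dotsE mulrDr h (dotC x be); ring.
Qed.

Lemma quad_gt0 al be ga x : 0 < al -> al * ga = 1 + dot be be -> 0 < quad al be ga x.
Proof.
move=> al0 h; rewrite -(pmulr_rgt0 _ al0) quad_sqr//.
by rewrite ltr_wpDl// dot_ge0.
Qed.

(** Dividing [1 + |f x|^2] by the stretch cancels the denominator [|x - a|^2] and leaves a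
    polynomial of degree two; for a similarity the stretch is constant. *)
Lemma normal_quad f : (0 < d)%N -> normal_form f -> exists al be ga,
  [/\ 0 < al, al * ga = 1 + dot be be &
  forall x y, f (Some x) = Some y -> stretch f x * quad al be ga x = 1 + dot y y].
Proof.
move=> d0 [l O b l0 oO ->|a b r O r0 oO ->].
  exists l, (b *m O^T), ((1 + dot b b) / l); split => //.
    by rewrite dot_orth; [field; rewrite gt_eqF|exact: orth_tr].
  move=> x _ [<-]; rewrite stretch_similarity// /quad !dotsE dot_orth//.
  have e1 : dot (x *m O) b = dot (b *m O^T) x by rewrite dot_mulmx dotC.
  by rewrite (dotC b (x *m O)) e1; field; rewrite gt_eqF.
set B := 1 + dot b b; set q := b *m O^T.
have B0 : 0 < B by rewrite ltr_wpDr// dot_ge0.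
(* The coefficients of [B / r |x - a|^2 + 2 <q, x - a> + r], expanded in [x]. *)
exists (B / r), (q - (B / r) *: a), (B / r * dot a a - 2 * dot q a + r); split.
- exact: divr_gt0.
- have qq : dot q q = dot b b by rewrite dot_orth//; exact: orth_tr.
  by rewrite !dotsE qq (dotC a q) /B; field; rewrite gt_eqF.
- move=> x y /=; case: ifPn => // xa [<-].
  have D0 : dot (x - a) (x - a) != 0 by rewrite dot_eq0 subr_eq0.
  rewrite stretch_iform// /quad.
  have -> : B / r * dot x x + 2 * dot (q - (B / r) *: a) x + (B / r * dot a a - 2 * dot q a + r) =
     B / r * dot (x - a) (x - a) + 2 * dot q (x - a) + r.
    by rewrite !dotsE (dotC x a); ring.
  have e1 : dot ((x - a) *m O) b = dot q (x - a) by rewrite dot_mulmx dotC.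
  rewrite [dot (b + _) _]dotDl !dotZl (dotDr _ _ b) (dotDr _ _ ((x - a) *m O)) !dotZr dot_orth//.
  rewrite (dotC b ((x - a) *m O)) e1.
  by move: (dot q (x - a)) => s; rewrite -/B /B; field; rewrite D0 gt_eqF.
Qed.

End Quadratic.

Section Chordal.
Context {R : realType} {d : nat} (d0 : (0 < d)%N).
Local Notation V := 'rV[R]_d.
Implicit Types (a b u v w x y be c : V) (O : 'M[R]_d) (l r al ga : R).
Implicit Types (f g : rhat R d -> rhat R d).

Lemma sqnorm_continuous : continuous (fun x : V => dot x x).
Proof.
move=> x; have [D _] := is_diff_comp (is_diff_pair (is_diff_id x) (is_diff_id x)) (is_diff_dot (x, x)).
exact: differentiable_continuous D.
Qed.

Lemma dotl_continuous b : continuous (fun x : V => dot b x).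
Proof.
move=> x; have [D _] := is_diff_comp (is_diff_pair (is_diff_cst b x) (is_diff_id x)) (is_diff_dot (b, x)).
exact: differentiable_continuous D.
Qed.

Lemma quad_continuous al be ga : continuous (quad al be ga).
Proof.
move=> x.
suff: {for x, continuous (fun y : V => al * dot y y + 2 * dot be y + ga)} by [].
apply: contD; last exact: cont_cst.
apply: contD; apply: contM.
- exact: cont_cst.
- exact: sqnorm_continuous.
- exact: cont_cst.
- exact: dotl_continuous.
Qed.

(** The condition under the [get] that defines [chordal_factor], named so that exhibiting one
    solution shows that the chosen function is a solution. *)
Definition chordal_spec f (h : rhat R d -> R) :=
  [/\ continuous h, forall p, 0 < h p &
    forall x y, f (Some x) = Some y ->
      h (Some x) = opnorm ('J (fpart f) x) * ((1 + enorm x ^+ 2) / (1 + enorm y ^+ 2))].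

(** At infinity the value is the quotient of the leading coefficients. The points where the ratio is
    off by [e] or more form a compact set, since there a quadratic growth is bounded by a linear
    one. *)
Lemma quad_ratio_continuous al be ga : 0 < al -> al * ga = 1 + dot be be ->
  continuous (fun p : rhat R d =>
    if p is Some x then (1 + dot x x) / quad al be ga x else al^-1).
Proof.
move=> al0 h [x|].
  have c1 : {for x, continuous (fun z : V => 1 + dot z z)}.
    by apply: contD; [exact: cont_cst|exact: sqnorm_continuous].
  have c2 : {for x, continuous (fun z : V => (quad al be ga z)^-1)}.
    by apply: continuousV; [rewrite gt_eqF// quad_gt0|exact: quad_continuous].
  exact: continuousM c1 c2.
apply/(@cvgrPdist_lt _ _ _ _ (nbhs_filter (None : rhat R d))) => e e0.
have q0 x := quad_gt0 x al0 h.
(* The difference of [al^-1] and the ratio is [(2 <be, x> + ga - al) / (al * quad x)], so [K] is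
   where the error is at least [e]. *)
pose K := [set x : V | e * (al * quad al be ga x) <= `|al - ga - 2 * dot be x|].
have Kc : compact K /\ closed K.
  have cK : closed K.
    rewrite (_ : K = (fun x => `|al - ga - 2 * dot be x| - e * (al * quad al be ga x)) @^-1` [set t | 0 <= t]); last first.
      by apply/seteqP; split => x; rewrite /K /= subr_ge0.
    apply: closed_comp; last exact: closed_ge.
    move=> x _.
    suff: {for x, continuous (fun y : V =>
      `|al - ga - 2 * dot be y| - e * (al * quad al be ga y))} by [].
    apply: contB; last first.
      by do 2![apply: contM; first exact: cont_cst]; exact: quad_continuous.
    apply: cont_normr; apply: contB; first exact: cont_cst.
    by apply: contM; [exact: cont_cst|exact: dotl_continuous].
  split => //; apply: bounded_closed_compact => //.
  set n := enorm be; set C := `|al - ga| + 2 * n + 2 * al * n * e.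
  (* On [K] with [|x| >= 1], dividing the inequality by [|x|] gives [e al^2 |x| <= C]; the summand 1
     covers the unit ball. *)
  exists (1 + C / (e * al ^+ 2)); split; first exact: num_real.
  move=> M CM x Kx; apply: le_trans (norm_le_enorm x) _; apply: le_trans (ltW CM).
  have n0 : 0 <= n := enorm_ge0 _.
  have C0 : 0 <= C by rewrite !addr_ge0// !mulr_ge0// ltW.
  have [x1|/ltW x1] := leP (enorm x) 1.
    by rewrite (le_trans x1)// lerDl divr_ge0// mulr_ge0// ?sqr_ge0// ltW.
  rewrite ler_wpDl// ler_pdivlMr ?mulr_gt0 ?exprn_gt0//.
  have x0 : 0 < enorm x by exact: lt_le_trans ltr01 x1.
  rewrite -(ler_pM2r x0).
  have bx := dot_norm_le be x.
  have t1 : `|al - ga - 2 * dot be x| <= `|al - ga| * enorm x + 2 * n * enorm x.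
    apply: le_trans (ler_normB _ _) _; apply: lerD; first by rewrite ler_peMr.
    by rewrite normrM ger0_norm// -mulrA ler_pM2l.
  have t2 : e * (al ^+ 2 * enorm x ^+ 2 - 2 * al * (n * enorm x)) <= e * (al * quad al be ga x).
    rewrite ler_pM2l// /quad !mulrDr h enorm_sqrE.
    have : - (n * enorm x) <= dot be x by move: bx; rewrite ler_norml => /andP[].
    have := dot_ge0 be; rewrite expr2; nra.
  rewrite /K /= in Kx.
  have := le_trans t2 (le_trans Kx t1).
  rewrite /C; lra.
exists K => // p; case: p => [x [[y nK [<-]]|//]|_] /=; last by rewrite subrr normr0.
move/negP: nK; rewrite -ltNge => nK.
have -> : al^-1 - (1 + dot y y) / quad al be ga y = (2 * dot be y - (al - ga)) / (al * quad al be ga y).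
  rewrite [in LHS]/quad [in X in _ = _ / (_ * X)]/quad; field.
  by rewrite -/(quad al be ga y) !gt_eqF.
rewrite normrM normfV (ger0_norm (ltW (mulr_gt0 al0 (q0 y)))) ltr_pdivrMr; last exact: mulr_gt0.
by rewrite distrC.
Qed.

Lemma chordal_exists f : normal_form f -> chordal_spec f (chordal_factor f).
Proof.
move=> nf; have [al [be [ga [al0 h Q]]]] := normal_quad d0 nf.
apply: (@getPex _ (chordal_spec f)).
exists (fun p : rhat R d => if p is Some x then (1 + dot x x) / quad al be ga x else al^-1).
split; first exact: quad_ratio_continuous.
- case=> [x|]; last by rewrite invr_gt0.
  by rewrite divr_gt0 ?quad_gt0// ltr_wpDr// dot_ge0.
- move=> x y fx; rewrite !enorm_sqrE -(Q _ _ fx) -stretchE.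
  have [P [_ s0 _]] := fpart_conformal d0 nf fx.
  have := quad_gt0 x al0 h; move: (quad _ _ _ _) (stretch f x) s0 => q s s0 q0.
  by field; rewrite !gt_eqF.
Qed.

(** The pole is left by a small shift along a unit vector, infinity by a far point on a line.
    Continuity then extends estimates from finite points to the whole sphere. *)
Lemma finite_dense f (p : rhat R d) (U : set (rhat R d)) : normal_form f -> nbhs p U ->
  exists x y, U (Some x) /\ f (Some x) = Some y.
Proof.
have [e e1] := @row_ne0 R d d0.
have en0 : e != 0 by rewrite -dot_eq0 e1 oner_eq0.
move=> nf; have [a Ha] : exists a, forall x, x != a -> exists y, f (Some x) = Some y.
  case: nf => [l O b _ _ ->|a b r O _ _ ->]; first by exists 0 => x _; exists (l *: (x *m O) + b).
  by exists a => x xa /=; rewrite (negbTE xa); eexists.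
case: p => [x|] pU.
- have [xa|xa] := eqVneq x a; last first.
    by have [y fx] := Ha _ xa; exists x, y; split => //; exact: nbhs_singleton pU.
  have ct : (fun t : R => x + t *: e) @ 0 --> x.
    have E : x = x + (0 : R) *: e by rewrite scale0r addr0.
    rewrite [X in _ --> X]E.
    by apply: cvgD; [exact: cvg_cst|apply: cvgZr_tmp; exact: cvg_id].
  have H : \forall t \near (0 : R)^', U (Some (x + t *: e)) /\ t != 0.
    near=> t; split; last by near: t; exact: nbhs_dnbhs_neq.
    by near: t; apply: nbhs_dnbhs; exact: ct pU.
  have [t [Ut t0]] := filter_ex H.
  have [y fy] : exists y, f (Some (x + t *: e)) = Some y.
    by apply: Ha; rewrite xa -subr_eq0 addrAC subrr add0r scaler_eq0 negb_or t0.
  by exists (x + t *: e), y.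
- case: pU => K [Kc _] KU.
  have [M [Mr HM]] := compact_bounded Kc.
  (* A vector of norm [1 + |M| + |a|] is outside the compact set and differs from the pole. *)
  pose t := (1 + `|M| + `|a|) / `|e|.
  have ne : 0 < `|e| by rewrite normr_gt0.
  have nz : `|t *: e| = 1 + `|M| + `|a|.
    by rewrite normrZ ger0_norm ?divfK ?gt_eqF// divr_ge0// !addr_ge0.
  have [y fy] : exists y, f (Some (t *: e)) = Some y.
    apply: Ha; apply/eqP => E; have := nz; rewrite E => /eqP.
    by rewrite -subr_eq0 opprD addrCA subrr addr0 oppr_eq0 gt_eqF// ltr_pwDl.
  exists (t *: e), y; split => //; apply: KU; left; exists (t *: e) => // Kt.
  have MM : M < `|M| + 2^-1 by rewrite (le_lt_trans (ler_norm M))// ltrDl invr_gt0.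
  have := HM _ MM _ Kt; apply/negP; rewrite -ltNge nz.
  have := normr_ge0 a; have := normr_ge0 M; lra.
Unshelve. all: by end_near. Qed.

Lemma chordal_le f k : normal_form f ->
  (forall x y, f (Some x) = Some y -> stretch f x * (1 + dot x x) <= k * (1 + dot y y)) ->
  forall p, chordal_factor f p <= k.
Proof.
move=> nf H p; have [hc h0 hE] := chordal_exists nf; rewrite leNgt; apply/negP => kp.
have kU : nbhs p [set q | k < chordal_factor f q].
  by apply: (hc p [set t | k < t]); apply: open_nbhs_nbhs; split; [exact: open_gt|].
have [x [y [/= kx fx]]] := finite_dense nf kU.
have := H _ _ fx; rewrite leNgt => /negP; apply.
have y0 : 0 < 1 + dot y y by rewrite ltr_wpDr// dot_ge0.
rewrite -ltr_pdivlMr//; move: kx; rewrite (hE _ _ fx) -stretchE !enorm_sqrE.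
by rewrite mulrA.
Qed.

Lemma chordal_ge f x y : normal_form f -> f (Some x) = Some y ->
  chordal_factor f (Some x) * (1 + dot y y) = stretch f x * (1 + dot x x).
Proof.
move=> nf fx; have [_ _ hE] := chordal_exists nf; rewrite (hE _ _ fx) -stretchE !enorm_sqrE.
have y0 : 0 < 1 + dot y y by rewrite ltr_wpDr// dot_ge0.
by rewrite mulrA divfK// gt_eqF.
Qed.

End Chordal.

(** * Discriminants and two-sided bounds for quadratic polynomials *)

Section QuadraticBounds.
Context {R : realType} {d : nat} (d0 : (0 < d)%N).
Local Notation V := 'rV[R]_d.
Implicit Types (a b u v w x y be c B : V) (k al ga A C : R).

(** The test points are the origin for [C], two opposite far points for [A], and a multiple of [B]
    for the discriminant. *)
Lemma quad_discriminant A B C : (forall x, 0 <= quad A B C x) ->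
  [/\ 0 <= A, 0 <= C & dot B B <= A * C].
Proof.
move=> H; have C0 : 0 <= C by have := H 0; rewrite /quad !dotsE !mulr0 !add0r.
have [e e1] := @row_ne0 R d d0.
have A0 : 0 <= A.
  rewrite leNgt; apply/negP => A0.
  (* From [t >= 1] and [A t = A - C] follows [A t^2 + C <= A < 0], while the values at [t e] and
     [-t e] add up to twice the left side. *)
  pose t := 1 + C / (- A).
  have t1 : 1 <= t by rewrite lerDl divr_ge0// oppr_ge0 ltW.
  have tA : A * t = A - C by rewrite /t; field; rewrite lt_eqF.
  have := H (t *: e); have := H (- t *: e); rewrite /quad !dotsE e1.
  have : A * (t * t) <= A * t by apply: ler_wnM2l; [exact: ltW|rewrite ler_peMl// (le_trans ler01)].
  rewrite tA !mulr1; nra.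
split => //; move: A0; rewrite le_eqVlt => /predU1P[A0|A0].
  rewrite -A0 mul0r leNgt; apply/negP => B0.
  have := H (- ((C + 1) / dot B B) *: B); rewrite /quad -A0 mul0r add0r !dotsE.
  have -> : 2 * (- ((C + 1) / dot B B) * dot B B) + C = - C - 2 by field; rewrite gt_eqF.
  lra.
(* The minimum of the polynomial is attained here. *)
have := H (- A^-1 *: B); rewrite /quad !dotsE.
rewrite -(pmulr_rge0 _ A0).
have -> : A * (A * (- A^-1 * (- A^-1 * dot B B)) + 2 * (- A^-1 * dot B B) + C) = A * C - dot B B.
  by field; rewrite gt_eqF.
by rewrite subr_ge0.
Qed.

(* The chordal factor [(1 + |x|^2) / quad x] of a Moebius map has minimum the
   inverse of its maximum: both bounds on [quad] say that [al + ga <= k + 1/k]. *)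
Lemma quad_upper k al be ga : 0 < k -> al * ga = 1 + dot be be ->
  (forall x, 1 + dot x x <= k * quad al be ga x) ->
  forall x, quad al be ga x <= k * (1 + dot x x).
Proof.
move=> k0 h H.
have [A0 C0 D] : [/\ 0 <= k * al - 1, 0 <= k * ga - 1 &
    dot (k *: be) (k *: be) <= (k * al - 1) * (k * ga - 1)].
  apply: quad_discriminant => x; have := H x; rewrite /quad !dotsE; lra.
rewrite !dotsE in D.
have kag : k * (al + ga) <= k ^+ 2 + 1.
  have : (k * al - 1) * (k * ga - 1) = k ^+ 2 * (al * ga) - k * (al + ga) + 1 by ring.
  by rewrite h; nra.
have A'0 : 0 <= k - al by rewrite -(pmulr_rge0 _ k0); move: kag; rewrite expr2; nra.
have C'0 : 0 <= k - ga by rewrite -(pmulr_rge0 _ k0); move: kag; rewrite expr2; nra.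
(* The discriminant condition of the claimed bound; by [h] it amounts to
   [k (al + ga) <= k^2 + 1]. *)
have D' : dot be be <= (k - al) * (k - ga).
  have -> : (k - al) * (k - ga) = k ^+ 2 - k * (al + ga) + al * ga by ring.
  rewrite h; lra.
move=> x; rewrite -subr_ge0.
have -> : k * (1 + dot x x) - quad al be ga x = (k - al) * dot x x - 2 * dot be x + (k - ga).
  by rewrite /quad; ring.
move: A'0; rewrite le_eqVlt => /predU1P[A'0|A'0].
  move: D'; rewrite -A'0 !mul0r => D'.
  have /eqP : dot be be = 0 by apply/eqP; rewrite eq_le D' dot_ge0.
  by rewrite dot_eq0 => /eqP->; rewrite dot0l mulr0 subrr add0r.
rewrite -(pmulr_rge0 _ A'0).
have -> : (k - al) * ((k - al) * dot x x - 2 * dot be x + (k - ga)) =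
    dot ((k - al) *: x - be) ((k - al) *: x - be) + ((k - al) * (k - ga) - dot be be).
  by rewrite !dotsE (dotC x be); ring.
by rewrite addr_ge0 ?dot_ge0// subr_ge0.
Qed.

End QuadraticBounds.

(** * Chordal bounds for conjugates by translations *)

Section ChordalBound.
Context {R : realType} {d : nat} (d0 : (0 < d)%N).
Local Notation V := 'rV[R]_d.
Implicit Types (a b u v w x y be c : V) (k al ga : R).
Implicit Types (f g : rhat R d -> rhat R d).

Definition conj c f := translation (- c) \o f \o translation c.

Lemma translationE c : @translation R d c = similarity 1 1%:M c.
Proof. by apply/funext => -[x|//]; rewrite /= mulmx1 scale1r. Qed.

Lemma normal_translation c : normal_form (@translation R d c).
Proof. by rewrite translationE; apply: NFsim (erefl _); [exact: ltr01|exact: orth1]. Qed.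

Lemma mobius_translation c : mobius (@translation R d c).
Proof. by rewrite translationE; apply: mobius_similarity; [exact: ltr01|exact: orth1]. Qed.

Lemma mobius_conj c f : mobius f -> mobius (conj c f).
Proof.
move=> mf; apply: mobius_comp (mobius_translation c).
exact: mobius_comp (mobius_translation (- c)) mf.
Qed.

Lemma conj_finite c f x y : f (Some x) = Some y -> conj c f (Some (x - c)) = Some (y - c).
Proof. by move=> fx; rewrite /conj /= subrK fx. Qed.

Lemma conj_finiteV c f x y : conj c f (Some x) = Some y -> f (Some (x + c)) = Some (y + c).
Proof.
by rewrite /conj /=; case: (f _) => //= z [<-]; rewrite subrK.
Qed.

Lemma stretch_translation c x : stretch (@translation R d c) x = 1.
Proof. by rewrite translationE stretch_similarity//; exact: orth1. Qed.

Lemma stretch_conj c f x y : mobius f -> f (Some x) = Some y ->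
  stretch (conj c f) (x - c) = stretch f x.
Proof.
move=> mf fx; have nf := mobius_normal mf.
have ntf : normal_form (translation (- c) \o f).
  by apply: mobius_normal; apply: mobius_comp mf; exact: mobius_translation.
have tx : translation c (Some (x - c)) = Some x by rewrite /= subrK.
have tfx : (translation (- c) \o f) (Some x) = Some (y - c) by rewrite /= fx.
have ty : translation (- c) (Some y) = Some (y - c) by [].
rewrite /conj (stretch_comp d0 (normal_translation c) ntf tx tfx).
rewrite (stretch_comp d0 nf (normal_translation (- c)) fx ty).
by rewrite !stretch_translation mulr1 mul1r.
Qed.

(* [kbound c k f] bounds the chordal factor of the conjugate of [f] by the
   translation by [c] at its finite points. *)
Definition kbound c k f := forall x y, f (Some x) = Some y ->
  stretch f x * (1 + dot (x - c) (x - c)) <= k * (1 + dot (y - c) (y - c)).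

Lemma mobius_quad c f : mobius f -> exists al be ga,
  [/\ 0 < al, al * ga = 1 + dot be be &
  forall x y, f (Some x) = Some y ->
    stretch f x * quad al be ga (x - c) = 1 + dot (y - c) (y - c)].
Proof.
move=> mf; have [al [be [ga [al0 h Q]]]] := normal_quad d0 (mobius_normal (mobius_conj c mf)).
exists al, be, ga; split => // x y fx.
by rewrite -(stretch_conj c mf fx); apply: Q; exact: conj_finite.
Qed.

(** A bound at the finite points is a polynomial inequality on a dense set, which continuity extends
    to all points; the converse multiplies by the positive stretch. *)
Lemma kboundP c k f al be ga : mobius f ->
  (forall x y, f (Some x) = Some y ->
    stretch f x * quad al be ga (x - c) = 1 + dot (y - c) (y - c)) ->
  kbound c k f <-> forall x, 1 + dot x x <= k * quad al be ga x.
Proof.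
move=> mf Q; have nf := mobius_normal mf.
split=> [H x|H x y fx]; last first.
  have [P [_ s0 _]] := fpart_conformal d0 nf fx.
  by rewrite -(Q _ _ fx) mulrCA ler_pM2l.
rewrite leNgt; apply/negP => kx.
pose h z := 1 + dot z z - k * quad al be ga z.
have ch : {for x, continuous h}.
  apply: contB; first by apply: contD; [exact: cont_cst|exact: sqnorm_continuous].
  by apply: contM; [exact: cont_cst|exact: quad_continuous].
have hx : nbhs x [set z | 0 < h z].
  apply: (ch [set t | 0 < t]); apply: open_nbhs_nbhs; split; first exact: open_gt.
  by rewrite /= /h subr_gt0.
have nU := @one_point_compactification_some_nbhs _ _ _ hx.
have [z [y [[z' /= hz [zE]] fz]]] := finite_dense d0 (mobius_normal (mobius_conj c mf)) nU.
rewrite {}zE {z'} in hz.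
have fzc := conj_finiteV fz.
have := H _ _ fzc; rewrite -(Q _ _ fzc) addrK mulrCA.
have [P [_ s0 _]] := fpart_conformal d0 nf fzc.
by rewrite ler_pM2l// leNgt -subr_gt0 hz.
Qed.

(** The translation of [quad_upper] back to maps: the chordal factor is at least [1 / k]. *)
Lemma kbound_lower c k f x y : 0 < k -> mobius f -> kbound c k f -> f (Some x) = Some y ->
  1 + dot (y - c) (y - c) <= k * stretch f x * (1 + dot (x - c) (x - c)).
Proof.
move=> k0 mf fk fx; have [al [be [ga [al0 h Q]]]] := mobius_quad c mf.
have /(kboundP k mf Q) H := fk.
have [P [_ s0 _]] := fpart_conformal d0 (mobius_normal mf) fx.
rewrite -(Q _ _ fx) (mulrC k) -mulrA ler_pM2l//.
exact: quad_upper.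
Qed.

Context {N : nat} {Omega Omega' : set V}.
Implicit Types Psi : cifs N Omega Omega'.

Lemma kappa_ltP c Psi (K : R) : (0 < N)%N ->
  (kappa c Psi < K%:E)%E <->
  exists k, [/\ 0 < k, k < K & forall i, kbound c k (Psi i)].
Proof.
move=> N0; split.
- move=> kK.
  have nc i := mobius_normal (mobius_conj c (cifs_mobius Psi i)).
  have cle i p : ((chordal_factor (conj c (Psi i)) p)%:E <= kappa c Psi)%E.
    apply: le_trans (_ : supn setT (chordal_factor (conj c (Psi i))) <= _)%E.
      by apply: ereal_sup_ubound; exists p.
    by rewrite /kappa; exact: le_bigmax.
  (* As [N > 0], [kappa] lies between a chordal factor and the real number [K]; hence it is real and
     serves as [k]. *)
  move: kK cle; case: (kappa c Psi) => [k|//|] kK cle; last first.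
    by have := cle (Ordinal N0) None; rewrite leeNy_eq.
  exists k; split.
  + have [_ h0 _] := chordal_exists d0 (nc (Ordinal N0)).
    by have := cle (Ordinal N0) None; rewrite lee_fin; apply: lt_le_trans; exact: h0.
  + by rewrite lte_fin in kK.
  + move=> i x y fx.
    rewrite -(stretch_conj c (cifs_mobius Psi i) fx) -(chordal_ge d0 (nc i) (conj_finite c fx)).
    by rewrite ler_pM2r ?ltr_wpDr ?dot_ge0// -lee_fin.
- move=> [k [k0 kK H]]; apply: le_lt_trans (_ : k%:E < _)%E; last by rewrite lte_fin.
  apply: bigmax_le => [|i _]; first exact: leNye.
  apply: ge_ereal_sup => _ [p _ <-]; rewrite lee_fin.
  have mf := cifs_mobius Psi i.
  apply: (chordal_le d0 (mobius_normal (mobius_conj c mf))) => x y /conj_finiteV fx.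
  have := H _ _ _ fx; rewrite -(stretch_conj c mf fx) !addrK.
  exact.
Qed.

End ChordalBound.

(** * Openness and the contraction rate *)

Section Interpolation.
Context {R : realType} {d : nat} (d0 : (0 < d)%N).
Local Notation V := 'rV[R]_d.
Implicit Types (a b u v w x y be c : V) (k al ga eta : R).

Lemma dot_delta b (j : 'I_d) : dot b (delta_mx 0 j) = b 0 j.
Proof.
rewrite dotE (bigD1 j)//= mxE !eqxx mulr1 big1 ?addr0// => i ij.
by rewrite mxE (negbTE ij) andbF mulr0.
Qed.

(** Around [x0] the polynomial is [al |u|^2 + 2 <b, u> + p0]. Second differences along an axis
    determine [al] and first differences the coordinates of [b], so small values at the nodes force
    small coefficients. *)
Lemma quad_interpolation x0 (s : R) : 0 < s -> exists2 C, 0 < C &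
  forall al be ga eta, `|quad al be ga x0| <= eta ->
  (forall j, `|quad al be ga (x0 + s *: delta_mx 0 j)| <= eta /\
             `|quad al be ga (x0 - s *: delta_mx 0 j)| <= eta) ->
  forall x, `|quad al be ga x| <= C * eta * (1 + dot x x).
Proof.
move=> s0; pose C1 : R := 2 / s ^+ 2 + d%:R / s + 1.
have C10 : 0 < C1 by rewrite ltr_wpDl// addr_ge0// divr_ge0// ?sqr_ge0// ltW.
exists (C1 * (2 + 2 * dot x0 x0)).
  by rewrite mulr_gt0// ltr_wpDr// mulr_ge0// dot_ge0.
move=> al be ga eta h0 h.
have eta0 : 0 <= eta := le_trans (normr_ge0 _) h0.
have [b PE] : exists b, forall u,
    quad al be ga (x0 + u) = al * dot u u + 2 * dot b u + quad al be ga x0.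
  by exists (be + al *: x0) => u; rewrite /quad !dotsE (dotC u x0); ring.
have De (j : 'I_d) : dot (delta_mx 0 j : V) (delta_mx 0 j) = 1.
  by rewrite dot_delta mxE !eqxx.
move: PE h0; move: (quad al be ga x0) => p0 PE h0.
have hal : `|al| <= 2 * eta / s ^+ 2.
  have [] := h (Ordinal d0); rewrite -scaleNr !PE !dotsE De !dot_delta.
  rewrite ler_pdivlMr ?exprn_gt0// -(@ger0_norm _ (s ^+ 2)) ?sqr_ge0// -normrM.
  by move: h0; rewrite !ler_norml; move: (b 0 _) => t; rewrite expr2; lra.
have hb j : `|b 0 j| <= eta / (2 * s).
  have [] := h j; rewrite -scaleNr !PE !dotsE De !dot_delta.
  have s2 : 0 < 2 * s by rewrite mulr_gt0.
  rewrite ler_pdivlMr// -[2 * s](ger0_norm (ltW s2)) -normrM.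
  by rewrite !ler_norml; move: (b 0 _) => t; lra.
move=> x; have [u ->] : exists u, x = x0 + u by exists (x - x0); rewrite addrC subrK.
rewrite PE.
have hbu : `|2 * dot b u| <= d%:R / s * eta * enorm u.
  rewrite normrM ger0_norm// dotE.
  have : `|\sum_j b 0 j * u 0 j| <= \sum_(j < d) eta / (2 * s) * enorm u.
    apply: le_trans (ler_norm_sum _ _ _) _; apply: ler_sum => j _.
    by rewrite normrM ler_pM// coord_le_enorm.
  rewrite sumr_const card_ord -(ler_pM2l (ltr0n R 2)) => /le_trans; apply.
  by rewrite -mulr_natl le_eqVlt; apply/orP; left; apply/eqP; field; rewrite gt_eqF.
have hu : enorm u <= 1 + dot u u.
  by rewrite -enorm_sqrE; have := sqr_ge0 (enorm u - 2^-1); rewrite !expr2; lra.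
have Eu := enorm_ge0 u.
have step1 : `|al * dot u u + 2 * dot b u + p0| <= C1 * eta * (1 + dot u u).
  apply: le_trans (ler_normD _ _) _.
  apply: le_trans (lerD (ler_normD _ _) h0) _.
  have t1 : `|al * dot u u| <= 2 / s ^+ 2 * eta * (1 + dot u u).
    rewrite normrM (ger0_norm (dot_ge0 u)).
    apply: ler_pM; rewrite ?dot_ge0//; last by rewrite lerDr.
    by rewrite mulrAC.
  have t2 : `|2 * dot b u| <= d%:R / s * eta * (1 + dot u u).
    apply: le_trans hbu _; rewrite ler_wpM2l// mulr_ge0// divr_ge0// ltW//.
  have t3 : eta <= eta * (1 + dot u u) by rewrite ler_peMr// lerDl dot_ge0.
  by apply: le_trans (lerD (lerD t1 t2) t3) _; rewrite /C1 !mulrDl !mul1r.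
apply: le_trans step1 _.
rewrite -!mulrA ler_pM2l// [leLHS]mulrC [in leRHS]mulrCA [leRHS]mulrC ler_wpM2r//.
(* Returning from [u] to [x0 + u] costs the factor [2 + 2 |x0|^2]. *)
have xx : dot u u <= 2 * dot (x0 + u) (x0 + u) + 2 * dot x0 x0.
  have := dot_ge0 (u + 2 *: x0); rewrite !dotsE (dotC u x0); lra.
have := dot_ge0 x0; have := dot_ge0 (x0 + u); nra.
Qed.

(** The point enters only through its distance to [c], so this is continuity of [(1 + t^2) / s] at
    one point of the plane. *)
Lemma distortion_modulus c y (s eta : R) : 0 < s -> 0 < eta ->
  exists2 e, 0 < e & forall y' s', enorm (y - y') < e -> `|s - s'| < e ->
  `|(1 + dot (y' - c) (y' - c)) / s' - (1 + dot (y - c) (y - c)) / s| <= eta.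
Proof.
move=> s0 eta0; pose G (p : R * R) := (1 + p.1 ^+ 2) / p.2.
have cG : {for (enorm (y - c), s), continuous G}.
  have c1 : {for (enorm (y - c), s), continuous (fun p : R * R => p.1)} by exact: cvg_fst.
  have c2 : {for (enorm (y - c), s), continuous (fun p : R * R => p.2)} by exact: cvg_snd.
  apply: contM; last by apply: continuousV => //=; rewrite gt_eqF.
  by apply: contD; [exact: cont_cst|exact: (contM c1 c1)].
have /nbhs_ballP[e /= e0 He] : nbhs (enorm (y - c), s) [set p | ball (G (enorm (y - c), s)) eta (G p)].
  by apply: cG; exact: nbhsx_ballx.
exists e => // y' s' yy' ss'.
have : ball (enorm (y - c), s) e (enorm (y' - c), s').
  split => //=; rewrite /ball/= ltr_norml; apply/andP; split.
    rewrite ltrNl opprB ltrBlDl; apply: le_lt_trans (enorm_distD y' y c) _.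
    by rewrite addrC ltrD2l -enormN opprB.
  by rewrite ltrBlDl; apply: le_lt_trans (enorm_distD y y' c) _; rewrite addrC ltrD2l.
move=> /He; rewrite /ball/= /G/= !enorm_sqrE distrC; exact: ltW.
Qed.

End Interpolation.

(** * Stability of chordal bounds under perturbation, and the bound on [lambda_max] *)

Section OpenU.
Context {R : realType} {d N : nat} (d0 : (0 < d)%N) (N0 : (0 < N)%N).
Local Notation V := 'rV[R]_d.
Context {Omega Omega' : set V}.
Implicit Types (a b u v w x y be c : V) (k al ga eta : R).
Implicit Types Phi Psi : cifs N Omega Omega'.

Lemma opnorm_ge0 (A : 'M[R]_d) : 0 <= opnorm A.
Proof.
by have := @enorm_le_opnorm R d A 0; rewrite mul0mx enorm0; apply.
Qed.

Lemma opnorm2_ge0 (B : {linear V -> 'M[R]_d}) : 0 <= opnorm2 B.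
Proof.
by have := @enorm_le_opnorm2 R d B 0 0; rewrite mul0mx enorm0; apply.
Qed.

Lemma opnorm_dist (A B : 'M[R]_d) : `|opnorm A - opnorm B| <= opnorm (A - B).
Proof.
have h (C D : 'M[R]_d) : opnorm C - opnorm D <= opnorm (C - D).
  by rewrite lerBlDr; have := opnorm_distD C D 0; rewrite !subr0.
by rewrite ler_norml h andbT lerNl opprB opnormB.
Qed.

Lemma d2_lt Phi Psi (e : R) i x : (d2 Phi Psi < e%:E)%E -> closure Omega x ->
  enorm (fpart (Phi i) x - fpart (Psi i) x) < e /\
  `|stretch (Phi i) x - stretch (Psi i) x| < e.
Proof.
move=> de Ox.
have: (c2dist (Omega := Omega) (fpart (Phi i)) (fpart (Psi i)) < e%:E)%E.
  by apply: (le_lt_trans _ de); rewrite /d2; exact: le_bigmax.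
rewrite /c2dist; set A := supn _ _; set B := supn _ _; set C := supn _ _ => ABC.
have A1 : ((enorm (fpart (Phi i) x - fpart (Psi i) x))%:E <= A)%E.
  by apply: ereal_sup_ubound; exists x.
have B1 : ((opnorm ('J (fpart (Phi i)) x - 'J (fpart (Psi i)) x))%:E <= B)%E.
  by apply: ereal_sup_ubound; exists x.
have C1 : ((opnorm2 (D2 (fpart (Phi i)) x \- D2 (fpart (Psi i)) x))%:E <= C)%E.
  by apply: ereal_sup_ubound; exists x.
have A0 : (0 <= A)%E by apply: le_trans A1; rewrite lee_fin enorm_ge0.
have B0 : (0 <= B)%E by apply: le_trans B1; rewrite lee_fin opnorm_ge0.
have C0 : (0 <= C)%E by apply: le_trans C1; rewrite lee_fin opnorm2_ge0.
split.
  rewrite -lte_fin; apply: le_lt_trans ABC; apply: le_trans A1 _.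
  by rewrite -addeA leeDl// adde_ge0.
rewrite !stretchE; apply: le_lt_trans (opnorm_dist _ _) _.
rewrite -lte_fin; apply: le_lt_trans ABC; apply: le_trans B1 _.
by rewrite addeAC leeDr// adde_ge0.
Qed.

Hypothesis OO' : closure Omega `<=` Omega'.

Lemma cifs_some Phi i x : closure Omega x -> Phi i (Some x) = Some (fpart (Phi i) x).
Proof.
move=> Ox; have := @cifs_finite _ _ _ _ _ Phi i x (OO' Ox).
by rewrite /fpart; case: (Phi i _).
Qed.

(** Supplies nodes for [quad_interpolation] inside [Omega], where [d2] controls the maps. *)
Lemma open_ball_points x0 : open Omega -> Omega x0 -> exists2 s : R, 0 < s &
  forall j : 'I_d, Omega (x0 + s *: delta_mx 0 j) /\ Omega (x0 - s *: delta_mx 0 j).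
Proof.
move=> oO Ox; have /nbhs_ballP[e /= e0 He] : nbhs x0 Omega by apply: open_nbhs_nbhs; split.
exists (e / 2); first exact: divr_gt0.
have H (t : R) (j : 'I_d) : `|t| = e / 2 -> Omega (x0 + t *: delta_mx 0 j).
  move=> te; apply: He; rewrite -ball_normE /= opprD addrA subrr sub0r normrN normrZ te.
  apply: (@le_lt_trans _ _ (e / 2 * 1)); last by rewrite mulr1 ltr_pdivrMr// ltr_pMr// ltr1n.
  rewrite ler_pM2l ?divr_gt0//; apply: le_trans (norm_le_enorm _) _.
  by rewrite enormE dot_delta mxE !eqxx sqrtr1.
move=> j; split; first by apply: H; rewrite ger0_norm// divr_ge0// ltW.
by rewrite -scaleNr; apply: H; rewrite normrN ger0_norm// divr_ge0// ltW.
Qed.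

Lemma kbound_stable Phi c k k' i : domain Omega -> 0 < k -> k < k' -> kbound c k (Phi i) ->
  exists2 e, 0 < e & forall Psi, (d2 Phi Psi < e%:E)%E -> kbound c k' (Psi i).
Proof.
move=> [[x0 Ox0] _ oO] k0 kk' Hk.
have [s s0 Hs] := open_ball_points oO Ox0.
have [C C0 HC] := quad_interpolation d0 (x0 - c) s0.
(* The polynomial of [Phi i] is compared with that of a nearby [Psi i] at the nodes, and by
   interpolation everywhere. *)
have [al [be [ga [al0 h Q]]]] := mobius_quad d0 c (cifs_mobius Phi i).
have /(kboundP d0 k (cifs_mobius Phi i) Q) HQ := Hk.
(* Chosen so that [k * C * eta = 1 - k / k'], the loss allowed in passing from [k] to [k']. *)
pose eta := (1 - k / k') / (k * C).
have k'0 := lt_trans k0 kk'.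
have eta0 : 0 < eta by rewrite divr_gt0 ?mulr_gt0// subr_gt0 ltr_pdivrMr// mul1r.
(* At a fixed point the polynomial is [1 + |y - c|^2] divided by the stretch, and both vary
   continuously with the map. *)
have pt x : Omega x -> exists2 e, 0 < e & forall Psi al' be' ga',
    (forall x y, Psi i (Some x) = Some y ->
      stretch (Psi i) x * quad al' be' ga' (x - c) = 1 + dot (y - c) (y - c)) ->
    (d2 Phi Psi < e%:E)%E ->
    `|quad (al' - al) (be' - be) (ga' - ga) (x - c)| <= eta.
  move=> Ox; have cx := subset_closure Ox.
  have fx := cifs_some Phi i cx.
  have [_ [_ t0 _]] := fpart_conformal d0 (mobius_normal (cifs_mobius Phi i)) fx.
  have [e e0 He] := distortion_modulus c (fpart (Phi i) x) t0 eta0.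
  exists e => // Psi al' be' ga' Q' dP.
  have [ey es] := d2_lt i dP cx.
  have gx := cifs_some Psi i cx.
  have [_ [_ t'0 _]] := fpart_conformal d0 (mobius_normal (cifs_mobius Psi i)) gx.
  have := He _ _ ey es; rewrite -(Q _ _ fx) -(Q' _ _ gx).
  have mulK (t q : R) : 0 < t -> t * q / t = q by move=> t1; field; rewrite gt_eqF.
  rewrite (mulK _ _ t0) (mulK _ _ t'0).
  congr (`|_| <= _); rewrite /quad !dotsE; ring.
(* The index [ord0] gives the centre; the others give [s e_j] for [false] and [-s e_j] for [true].
   Finitely many nodes admit a common [e]. *)
have H : \forall e \near 0^'+, forall j : 'I_d.+1 * bool, forall Psi al' be' ga',
    (forall x y, Psi i (Some x) = Some y ->
      stretch (Psi i) x * quad al' be' ga' (x - c) = 1 + dot (y - c) (y - c)) ->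
    (d2 Phi Psi < e%:E)%E ->
    let v := oapp (fun j' => (-1) ^+ j.2 *: (s *: delta_mx 0 j')) 0 (unlift ord0 j.1) in
    `|quad (al' - al) (be' - be) (ga' - ga) (x0 + v - c)| <= eta.
  apply: filter_forall => -[j b].
  set v := oapp _ _ _.
  have Ov : Omega (x0 + v).
    rewrite /v; case: (unlift ord0 j) => [j'|] /=; last by rewrite addr0.
    have [Hp Hm] := Hs j'; case: (b) => /=; last by rewrite expr0 scale1r.
    by rewrite expr1 scaleN1r.
  have [e e0 He] := pt _ Ov.
  near=> e' => Psi al' be' ga' Q' dP /=; apply: He Q' _; apply: lt_le_trans dP _.
  by rewrite lee_fin; near: e'; exact: nbhs_right_le.
have [e [He e0]] : exists e, (forall j : 'I_d.+1 * bool, forall Psi al' be' ga',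
    (forall x y, Psi i (Some x) = Some y ->
      stretch (Psi i) x * quad al' be' ga' (x - c) = 1 + dot (y - c) (y - c)) ->
    (d2 Phi Psi < e%:E)%E ->
    let v := oapp (fun j' => (-1) ^+ j.2 *: (s *: delta_mx 0 j')) 0 (unlift ord0 j.1) in
    `|quad (al' - al) (be' - be) (ga' - ga) (x0 + v - c)| <= eta) /\ 0 < e.
  by apply: (@filter_ex _ (0^'+)); apply: filterI => //; exact: nbhs_right_gt.
exists e => // Psi dP.
have [al' [be' [ga' [al'0 h' Q']]]] := mobius_quad d0 c (cifs_mobius Psi i).
apply/(kboundP d0 k' (cifs_mobius Psi i) Q').
have key x : `|quad (al' - al) (be' - be) (ga' - ga) x| <= C * eta * (1 + dot x x).
  apply: HC => [|j].
    by have := He (ord0, false) _ _ _ _ Q' dP; rewrite unlift_none /= addr0.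
  have := He (lift ord0 j, false) _ _ _ _ Q' dP; rewrite liftK /= expr0 scale1r addrAC => h1.
  by have := He (lift ord0 j, true) _ _ _ _ Q' dP; rewrite liftK /= expr1 scaleN1r addrAC => h2.
move=> x; have := key x; rewrite ler_norml => /andP[kx _].
have E : quad (al' - al) (be' - be) (ga' - ga) x = quad al' be' ga' x - quad al be ga x.
  by rewrite /quad !dotsE; ring.
have n0 : 0 < 1 + dot x x by rewrite ltr_wpDr// dot_ge0.
have := HQ x; move: kx; rewrite E.
have : k * (C * eta * (1 + dot x x)) = (1 - k / k') * (1 + dot x x).
  by rewrite /eta; field; rewrite !gt_eqF.
move: (1 + dot x x) (quad al' be' ga' x) (quad al be ga x) (C * eta) n0 => n q' q Ce n0 h1 h2 h3.
have h4 : k / k' * n <= k * q'.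
  have : k * q - k * q' <= k * (Ce * n) by rewrite -mulrBr ler_pM2l//; lra.
  rewrite h1; lra.
by move: h4; rewrite mulrAC -mulrA ler_pM2l// ler_pdivrMr// mulrC.
Unshelve. all: by end_near. Qed.

Lemma open_Uset : domain Omega -> open (@Uset R d N Omega Omega').
Proof.
move=> dO; rewrite openE => Phi [c _ /= /(kappa_ltP d0 c _ _ N0)[k [k0 kK Hk]]].
set K := N%:R `^ _ in kK.
(* A perturbation may raise the bound from [k] to [k'], which is still below [K]. *)
pose k' := (k + K) / 2.
have kk' : k < k' by rewrite /k'; lra.
have k'K : k' < K by rewrite /k'; lra.
have H : \forall e \near 0^'+, forall i : 'I_N, forall Psi, (d2 Phi Psi < e%:E)%E -> kbound c k' (Psi i).
  apply: filter_forall => i.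
  have [e e0 He] := kbound_stable dO k0 kk' (Hk i).
  near=> e' => Psi dP; apply: He; apply: lt_le_trans dP _.
  by rewrite lee_fin; near: e'; exact: nbhs_right_le.
have [e [He e0]] : exists e, (forall i : 'I_N, forall Psi, (d2 Phi Psi < e%:E)%E -> kbound c k' (Psi i)) /\ 0 < e.
  by apply: (@filter_ex _ (0^'+)); apply: filterI => //; exact: nbhs_right_gt.
apply/nbhs_ballP; exists e => // Psi dP; exists c => //.
apply/(kappa_ltP d0 c _ _ N0); exists k'; split => //; first exact: lt_trans kk'.
by move=> i; exact: He.
Unshelve. all: by end_near. Qed.

Lemma compact_closure : bounded_set Omega -> compact (closure Omega).
Proof.
move=> [M [Mr HM]]; apply: bounded_closed_compact; last exact: closed_closure.
exists M; split => // M' MM' x Ox.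
have cl : closed [set y : V | `|y| <= M'].
  rewrite (_ : [set y : V | _] = (fun y : V => `|y|) @^-1` [set t | t <= M']); last by [].
  by apply: closed_comp; [move=> y _; exact: norm_continuous|exact: closed_le].
by apply: cl; apply: closure_subset Ox => y /(HM _ MM').
Qed.

Lemma Uset_lambda_max Psi : domain Omega -> bounded_set Omega -> Uset Psi ->
  ((N%:R `^ (- d%:R^-1))%:E < lambda_max Psi)%E.
Proof.
move=> [nO _ _] bO [c _ /= /(kappa_ltP d0 c _ _ N0)[k [k0 kK Hk]]].
have cO0 : closure Omega !=set0 by case: nO => x Ox; exists x; exact: subset_closure.
have cont : {within closure Omega, continuous (fun x : V => dot (x - c) (x - c))}.
  apply: continuous_subspaceT => x.
  by have [D _] := is_diff_sqdist c x; exact: differentiable_continuous D.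
have [x xO xmin] := compact_EVT_min cO0 (compact_closure bO) cont.
rewrite inE in xO.
pose i := Ordinal N0.
have fx := cifs_some Psi i xO.
(* The image lies in [Omega], so it is no closer to [c] than the nearest point [x]. *)
have xy : dot (x - c) (x - c) <= dot (fpart (Psi i) x - c) (fpart (Psi i) x - c).
  by apply: xmin; rewrite inE; apply: subset_closure; exact: cifs_self.
have low := kbound_lower d0 k0 (cifs_mobius Psi i) (Hk i) fx.
have [_ [_ t0 _]] := fpart_conformal d0 (mobius_normal (cifs_mobius Psi i)) fx.
have ks : 1 <= k * stretch (Psi i) x.
  rewrite leNgt; apply/negP => ks; move: low; apply/negP; rewrite -ltNge.
  have := dot_ge0 (x - c); have := mulr_gt0 k0 t0; nra.
apply: (@lt_le_trans _ _ (stretch (Psi i) x)%:E).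
  rewrite lte_fin powRN; apply: (@lt_le_trans _ _ k^-1).
    by rewrite ltf_pV2 ?posrE//; exact: lt_trans kK.
  by rewrite -ler_pdivrMl// mulr1 in ks.
apply: le_trans (_ : supn (closure Omega) (fun x => opnorm ('J (fpart (Psi i)) x)) <= _)%E.
  by apply: ereal_sup_ubound; exists x; rewrite ?stretchE.
by rewrite /lambda_max; exact: le_bigmax.
Qed.

End OpenU.

(** * Separation of logarithmic derivatives *)

Section Packing.
Context {R : realType} {d : nat} (d0 : (0 < d)%N).
Local Notation V := 'rV[R]_d.

(** Cut the cube of side [2 M] into cells of side [sep / d]. Points in one cell differ by less than
    [sep / d] in each coordinate, hence by less than [sep], so distinct indices occupy distinct
    cells. *)
Lemma card_separated (T : finType) (t : T -> V) (M sep : R) : 0 <= M -> 0 < sep ->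
  (forall w, enorm (t w) <= M) ->
  (forall w w', w != w' -> sep <= enorm (t w - t w')) ->
  #|T|%:R <= (2 * M * d%:R / sep + 1) ^+ d.
Proof.
move=> M0 sep0 tM tsep.
have dR0 : 0 < d%:R :> R by rewrite ltr0n.
pose h := sep / d%:R; have h0 : 0 < h by rewrite divr_gt0.
have bnd w j : 0 <= (t w ord0 j + M) / h <= 2 * M / h.
  have := le_trans (coord_le_enorm (t w) j) (tM w); rewrite ler_norml => /andP[lo hi].
  rewrite divr_ge0 ?(ltW h0)//=; last by rewrite addrC -lerBlDl sub0r.
  by rewrite ler_pM2r ?invr_gt0//; lra.
pose q := Num.trunc (2 * M / h).
have Mh0 : 0 <= 2 * M / h by rewrite divr_ge0 ?mulr_ge0// ltW.
have trq w (j : 'I_d) : (Num.trunc ((t w ord0 j + M) / h) < q.+1)%N.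
  have /andP[b0 b1] := bnd w j.
  by rewrite ltnS; apply: le_truncn.
pose F w : {ffun 'I_d -> 'I_q.+1} := [ffun j => Ordinal (trq w j)].
have injF : injective F.
  move=> w w' /ffunP FE; apply/eqP/negPn/negP => ww'.
  have := tsep _ _ ww'; apply/negP; rewrite -ltNge.
  apply: le_lt_trans (enorm_le_norm _) _.
  rewrite mulrC -ltr_pdivlMr//.
  rewrite /Num.norm/= mx_normrE; apply: bigmax_lt => //= -[i j] _ /=.
  rewrite ord1 !mxE; have := FE j; rewrite !ffunE => /(congr1 val) /= E.
  have /andP[b0 _] := bnd w j; have /andP[b0' _] := bnd w' j.
  have := truncn_itv b0; have := truncn_itv b0'; rewrite E => /andP[l1 u1] /andP[l2 u2].
  have : `|(t w ord0 j + M) / h - (t w' ord0 j + M) / h| < 1.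
    by move: u1 u2; rewrite -natr1 ltr_norml; lra.
  rewrite -mulrBl normrM (gtr0_norm (_ : 0 < h^-1)) ?invr_gt0// ltr_pdivrMr// mul1r.
  by rewrite opprD addrACA subrr addr0.
have := leq_card _ injF; rewrite card_ffun !card_ord => cardT.
apply: (@le_trans _ _ ((q.+1 ^ d)%N%:R)); first by rewrite ler_nat.
rewrite natrX; apply: lerXn2r; rewrite ?nnegrE ?ler0n//.
  by rewrite addr_ge0// divr_ge0 ?mulr_ge0// ltW.
rewrite -natr1 lerD2r.
have -> : 2 * M * d%:R / sep = 2 * M / h by rewrite /h invfM invrK mulrA mulrAC.
by have /andP[] := truncn_itv Mh0.
Qed.

Lemma bernoulli (q : R) n : 0 <= q -> 1 + n%:R * q <= (1 + q) ^+ n.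
Proof.
move=> q0; elim: n => [|n IH]; first by rewrite mul0r addr0 expr0.
rewrite exprS -natr1 mulrDl mul1r.
have := ler_wpM2l (_ : 0 <= 1 + q) IH; rewrite addr_ge0// => /(_ isT).
have : 0 <= n%:R * q * q by rewrite !mulr_ge0.
nra.
Qed.

Lemma geometric_unbounded (q B : R) : 1 < q -> exists n, B < q ^+ n.
Proof.
move=> q1; have q0 : 0 < q - 1 by rewrite subr_gt0.
exists (Num.trunc (`|B| / (q - 1))).+1.
have B0 : 0 <= `|B| / (q - 1) by rewrite divr_ge0// ltW.
have := bernoulli (Num.trunc (`|B| / (q - 1))).+1 (ltW q0).
rewrite [1 + (q - 1)]addrC subrK; apply: lt_le_trans.
have /andP[_] := truncn_itv B0; rewrite ltr_pdivrMr// => h.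
by apply: le_lt_trans (ler_norm _) _; apply: lt_trans h _; rewrite ltrDr.
Qed.

End Packing.

(** For words, the first letter is applied first, so the common prefix [u] is the inner map shared
    by both compositions. *)
Lemma seq_first_difference (T : eqType) (s t : seq T) : size s = size t -> s <> t ->
  exists u i j s' t', [/\ s = u ++ i :: s', t = u ++ j :: t', size s' = size t' & i <> j].
Proof.
elim: s t => [|a s IH] [|b t] //= [st] ab.
have [E|E] := eqVneq a b; last by exists [::], a, b, s, t; split => //; exact/eqP.
have {}ab : s <> t by move=> E'; apply: ab; rewrite E E'.
have [u [i [j [s' [t' [-> -> h ij]]]]]] := IH _ st ab.
by exists (a :: u), i, j, s', t'; rewrite E.
Qed.

(** * Comparison of logarithmic derivatives at two points *)

Section LogDerivative.
Context {R : realType} {d : nat} (d0 : (0 < d)%N).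
Local Notation V := 'rV[R]_d.
Implicit Types (a b u v w x y z : V) (k M D : R).
Implicit Types (f g : rhat R d -> rhat R d).

Lemma sqr_logder_pole a x (T : V) : x != a -> T = - (2 / dot (x - a) (x - a)) *: (x - a) ->
  dot T T = 4 / dot (x - a) (x - a).
Proof.
rewrite -subr_eq0 -dot_eq0 => xa ->; rewrite dotZl dotZr; field.
by rewrite xa.
Qed.

(** The inverses [p / |p|^2] and [q / |q|^2] of two vectors are at distance [|p - q| / (|p| |q|)];
    here [p = x - a] and [q = x - b]. *)
Lemma sqr_logder_poles a b x (T S : V) : x != a -> x != b ->
  T = - (2 / dot (x - a) (x - a)) *: (x - a) ->
  S = - (2 / dot (x - b) (x - b)) *: (x - b) ->
  dot (T - S) (T - S) = 4 * dot (a - b) (a - b) / (dot (x - a) (x - a) * dot (x - b) (x - b)).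
Proof.
rewrite -subr_eq0 -dot_eq0 => xa; rewrite -subr_eq0 -dot_eq0 => xb -> ->.
have -> : a - b = (x - b) - (x - a) by apply/rowP => j; rewrite !mxE; ring.
move: (x - a) (x - b) xa xb => p q p0 q0.
rewrite !dotsE (dotC q p); field.
by rewrite p0 q0.
Qed.

(** The bound [M] keeps the pole at distance at least [2 / M] from [z], so the triangle inequality
    becomes multiplicative: [|z - a| + D <= (1 + D M / 2) |z - a|]. *)
Lemma pole_distortion a y z M D : 0 < M -> y != a -> z != a -> enorm (y - z) <= D ->
  2 / enorm (z - a) <= M ->
  dot (y - a) (y - a) <= (1 + D * M / 2) ^+ 2 * dot (z - a) (z - a).
Proof.
move=> M0 ya za yz; have e0 : 0 < enorm (z - a) by rewrite enorm_gt0 subr_eq0.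
rewrite ler_pdivrMr// => h; rewrite -!enorm_sqrE -exprMn.
have D0 : 0 <= D := le_trans (enorm_ge0 _) yz.
apply: lerXn2r; rewrite ?nnegrE ?enorm_ge0//.
  by rewrite mulr_ge0// ?enorm_ge0// addr_ge0// divr_ge0// mulr_ge0// ltW.
apply: le_trans (enorm_distD y z a) _; rewrite mulrDl mul1r addrC lerD2l.
apply: le_trans yz _; nra.
Qed.

Let ler_pdiv_scale (A B l e : R) : 0 < A -> 0 < B -> 0 <= e -> A <= l * B ->
  e / B <= l * (e / A).
Proof.
move=> A0 B0 e0 h; rewrite mulrA ler_pdivrMr// mulrAC ler_pdivlMr//.
by rewrite [l * e]mulrC -mulrA ler_wpM2l.
Qed.

(* [|T_f - T_g|] at a point [x] is, up to the factor 2, the distance of the poles of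
   [f] and [g] after an inversion centred at [x]; moving [x] by [D] changes the
   distances to the poles by a bounded factor as the poles stay at distance [2 / M]. *)
Lemma logder_distortion f g y z fy fz gy gz M D : normal_form f -> normal_form g ->
  0 < M -> 0 <= D -> f (Some y) = Some fy -> f (Some z) = Some fz ->
  g (Some y) = Some gy -> g (Some z) = Some gz -> enorm (y - z) <= D ->
  enorm (logder f z) <= M -> enorm (logder g z) <= M ->
  enorm (logder f z - logder g z) <= (1 + D * M / 2) ^+ 2 * enorm (logder f y - logder g y).
Proof.
move=> nf ng M0 D0 hfy hfz hgy hgz yz.
set L := 1 + D * M / 2.
have L1 : 1 <= L by rewrite lerDl divr_ge0// mulr_ge0// ltW.
have L2 : 1 <= L ^+ 2 by exact: exprn_ege1.
(* Squared norms are compared; each of the two poles contributes a factor [L^2]. *)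
have sq u v : dot u u <= L ^+ 4 * dot v v -> enorm u <= L ^+ 2 * enorm v.
  rewrite -!enorm_sqrE (exprM L 2 2) -exprMn ler_pXn2r// nnegrE ?enorm_ge0//.
  by rewrite mulr_ge0 ?enorm_ge0// (le_trans ler01).
have pole a T : z != a -> T = - (2 / dot (z - a) (z - a)) *: (z - a) ->
    enorm T <= M -> 2 / enorm (z - a) <= M.
  move=> za TE; apply: le_trans; rewrite TE enormZ normrN.
  rewrite -enorm_sqrE ger0_norm ?divr_ge0 ?sqr_ge0//.
  have e0 : 0 < enorm (z - a) by rewrite enorm_gt0 subr_eq0.
  by rewrite le_eqVlt; apply/orP; left; apply/eqP; field; rewrite gt_eqF.
(* The case in which one map is a similarity: its term vanishes and one pole remains. *)
have single a T S : z != a -> y != a ->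
    T = - (2 / dot (z - a) (z - a)) *: (z - a) -> S = - (2 / dot (y - a) (y - a)) *: (y - a) ->
    enorm T <= M -> enorm T <= L ^+ 2 * enorm S.
  move=> za ya TE SE /(pole _ _ za TE) Mz; apply: sq.
  rewrite (sqr_logder_pole za TE) (sqr_logder_pole ya SE).
  have ya0 : 0 < dot (y - a) (y - a) by rewrite dot_gt0 subr_eq0.
  have za0 : 0 < dot (z - a) (z - a) by rewrite dot_gt0 subr_eq0.
  have h := pole_distortion M0 ya za yz Mz; rewrite -/L in h.
  apply: le_trans (ler_pdiv_scale ya0 za0 _ h) _ => //.
  by rewrite ler_wpM2r ?divr_ge0 ?(ltW ya0)// ler_weXn2l.
case: nf hfy hfz => [l O b l0 oO ->|a b r O r0 oO ->] /=.
- rewrite !logder_similarity//.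
  case: ng hgy hgz => [l' O' b' l'0 oO' ->|a b' r' O' r'0 oO' ->] /=.
    by rewrite !logder_similarity// subrr enorm0 mulr0.
  case: ifPn => // ya; case: ifPn => // za _ _ _ _ _ hg.
  have flip (T S : V) (B : R) : enorm T <= B * enorm S -> enorm (0 - T) <= B * enorm (0 - S).
    by rewrite !sub0r !enormN.
  apply: flip.
  have Tz := logder_iform d0 b' r'0 oO' za; have Ty := logder_iform d0 b' r'0 oO' ya.
  exact: single za ya Tz Ty hg.
- case: ifPn => // ya; case: ifPn => // za.
  case: ng hgy hgz => [l' O' b' l'0 oO' ->|a' b' r' O' r'0 oO' ->] /=.
    rewrite !logder_similarity// => _ _ _ _ h _.
    have flip (T S : V) (B : R) : enorm T <= B * enorm S -> enorm (T - 0) <= B * enorm (S - 0).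
      by rewrite !subr0.
    apply: flip.
    have Tz := logder_iform d0 b r0 oO za; have Ty := logder_iform d0 b r0 oO ya.
    exact: single za ya Tz Ty h.
  case: ifPn => // ya'; case: ifPn => // za' _ _ _ _ hf hg.
  apply: sq.
  have Tz := logder_iform d0 b r0 oO za; have Ty := logder_iform d0 b r0 oO ya.
  have Sz := logder_iform d0 b' r'0 oO' za'; have Sy := logder_iform d0 b' r'0 oO' ya'.
  rewrite [leLHS](sqr_logder_poles za za' Tz Sz) [X in _ <= _ * X](sqr_logder_poles ya ya' Ty Sy).
  have h1 := pole_distortion M0 ya za yz (pole _ _ za Tz hf).
  have h2 := pole_distortion M0 ya' za' yz (pole _ _ za' Sz hg).
  rewrite -/L in h1 h2.
  have p1 : 0 < dot (y - a) (y - a) by rewrite dot_gt0 subr_eq0.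
  have p2 : 0 < dot (z - a) (z - a) by rewrite dot_gt0 subr_eq0.
  have p3 : 0 < dot (y - a') (y - a') by rewrite dot_gt0 subr_eq0.
  have p4 : 0 < dot (z - a') (z - a') by rewrite dot_gt0 subr_eq0.
  have p5 := dot_ge0 (a - a').
  apply: ler_pdiv_scale; rewrite ?mulr_gt0 ?mulr_ge0//.
  have -> : L ^+ 4 = L ^+ 2 * L ^+ 2 by rewrite -exprD.
  by rewrite mulrACA; apply: ler_pM => //; exact: ltW.
Qed.

End LogDerivative.

Section UniformBounds.
Context {R : realType} {N : nat}.

Lemma uniform_lt (P : 'I_N -> R -> Prop) (B : R) : 0 < B ->
  (forall i r s, r <= s -> P i r -> P i s) ->
  (forall i, exists2 r, r < B & P i r) -> exists r, [/\ 0 <= r, r < B & forall i, P i r].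
Proof.
move=> B0 Pmon H.
have /choice[b Hb] : forall i, exists r, r < B /\ P i r.
  by move=> i; have [r] := H i; exists r.
exists (\big[Num.max/0]_i b i); split.
- exact: bigmax_ge_id.
- by apply: bigmax_lt => // i _; case: (Hb i).
- by move=> i; apply: (Pmon i (b i)); [exact: le_bigmax|case: (Hb i)].
Qed.

Lemma uniform_ub (P : 'I_N -> R -> Prop) :
  (forall i r s, r <= s -> P i r -> P i s) ->
  (forall i, exists r, P i r) -> exists2 r, 0 <= r & forall i, P i r.
Proof.
move=> Pmon /choice[b Hb]; exists (\big[Num.max/0]_i b i); first exact: bigmax_ge_id.
by move=> i; apply: (Pmon i (b i)) => //; exact: le_bigmax.
Qed.

End UniformBounds.

(** * Compositions along words, and the counting argument *)

Section Words.
Context {R : realType} {d N : nat} (d0 : (0 < d)%N) (N0 : (0 < N)%N).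
Local Notation V := 'rV[R]_d.
Context {Omega Omega' : set V}.
Hypothesis OO' : closure Omega `<=` Omega'.
Hypothesis bO : bounded_set Omega.
Variable Psi : cifs N Omega Omega'.
Implicit Types (a b x y z c : V) (s t u : seq 'I_N).

(** The identity is written as a translation in order to be a Moebius map. *)
Lemma fword_nil : fword Psi [::] = translation 0.
Proof. by apply/funext => -[x|//]; rewrite /= addr0. Qed.

Lemma fword_rcons s i : fword Psi (rcons s i) = Psi i \o fword Psi s.
Proof. by rewrite /fword foldl_rcons. Qed.

Lemma fword_cat s t : fword Psi (s ++ t) = fword Psi t \o fword Psi s.
Proof.
elim/last_ind: t => [|t i IH]; first by rewrite cats0.
by rewrite -rcons_cat !fword_rcons IH.
Qed.

Lemma mobius_fword s : mobius (fword Psi s).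
Proof.
elim/last_ind: s => [|s i IH].
  by rewrite fword_nil; exact: mobius_translation.
by rewrite fword_rcons; apply: mobius_comp IH; exact: cifs_mobius.
Qed.

Lemma normal_fword s : normal_form (fword Psi s).
Proof. exact: mobius_normal (mobius_fword s). Qed.

Lemma fword_closure s x : closure Omega x ->
  closure Omega (fpart (fword Psi s) x) /\ fword Psi s (Some x) = Some (fpart (fword Psi s) x).
Proof.
move=> Ox; suff [y Oy E] : exists2 y, closure Omega y & fword Psi s (Some x) = Some y.
  by rewrite (fpart_finite E).
elim/last_ind: s => [|s i [y Oy E]]; first by exists x.
exists (fpart (Psi i) y); last by rewrite fword_rcons /= E cifs_some.
by apply: subset_closure; exact: cifs_self.
Qed.

Lemma TfinE s : Tfin Psi s = logder (fword Psi s).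
Proof. by rewrite logderE /Tfin; congr grad; apply/funext => x; rewrite stretchE. Qed.

Lemma stretch_fword_lower c k x s : 0 < k -> (forall i, kbound c k (Psi i)) ->
  closure Omega x ->
  1 <= k ^+ size s * stretch (fword Psi s) x * (1 + dot (x - c) (x - c)).
Proof.
move=> k0 Hk Ox.
(* The induction keeps the image term on the left, where the bound for the next letter takes it
   up. *)
suff: 1 + dot (fpart (fword Psi s) x - c) (fpart (fword Psi s) x - c) <=
    k ^+ size s * stretch (fword Psi s) x * (1 + dot (x - c) (x - c)).
  by apply: le_trans; rewrite lerDl dot_ge0.
elim/last_ind: s => [|s i IH].
  have s1 : stretch (fword Psi [::]) x = 1 by rewrite fword_nil; exact: stretch_translation.
  by rewrite s1 expr0 !mul1r.
have [Oy E] := fword_closure s Ox.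
have E' := cifs_some OO' Psi i Oy.
rewrite fword_rcons size_rcons (stretch_comp d0 (normal_fword s) (mobius_normal (cifs_mobius Psi i)) E E').
have -> : fpart (Psi i \o fword Psi s) x = fpart (Psi i) (fpart (fword Psi s) x).
  by apply: fpart_finite; rewrite /= E E'.
have low := kbound_lower d0 k0 (cifs_mobius Psi i) (Hk i) E'.
have [_ [_ t0 _]] := fpart_conformal d0 (mobius_normal (cifs_mobius Psi i)) E'.
apply: le_trans low _.
apply: le_trans (ler_wpM2l (ltW (mulr_gt0 k0 t0)) IH) _.
rewrite exprS.
have E3 (p q r n : R) : k * p * (n * q * r) = k * n * (p * q) * r by ring.
by rewrite E3.
Qed.

Lemma stretch_lambda : (exists x, closure Omega x) -> exists l, [/\ 0 <= l, l < 1 &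
  forall i x, closure Omega x -> stretch (Psi i) x <= l].
Proof.
move=> nO; have [|||l [l0 l1 Hl]] := @uniform_lt R N (fun i l => forall x, closure Omega x -> stretch (Psi i) x <= l) 1.
- exact: ltr01.
- by move=> i r s rs H x /H /le_trans; apply.
- move=> i.
  (* The logarithm of the stretch is differentiable, hence continuous, so the stretch attains its
     maximum on the compact closure, where it is below 1. *)
  have cont : {within closure Omega, continuous (fun x : V => ln (stretch (Psi i) x))}.
    apply: continuous_in_subspaceT => x; rewrite inE => Ox.
    have [D _] := is_diff_log d0 (mobius_normal (cifs_mobius Psi i)) (cifs_some OO' Psi i Ox).
    exact: differentiable_continuous D.
  have [x xO xmax] := compact_EVT_max nO (compact_closure bO) cont.
  rewrite inE in xO; exists (stretch (Psi i) x); first by rewrite stretchE; exact: cifs_contract.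
  move=> y Oy; have := xmax y; rewrite inE => /(_ Oy) lnle.
  have [_ [_ sx _]] := fpart_conformal d0 (mobius_normal (cifs_mobius Psi i)) (cifs_some OO' Psi i xO).
  have [_ [_ sy _]] := fpart_conformal d0 (mobius_normal (cifs_mobius Psi i)) (cifs_some OO' Psi i Oy).
  have ln2 (p q : R) : 0 < p -> 0 < q -> ln p <= ln q -> p <= q.
    by move=> p0 q0; rewrite ler_ln ?posrE.
  exact: ln2 sy sx lnle.
- by exists l; split => // i x; exact: Hl.
Qed.

(** A finite pole lies outside the closed set [closure Omega], hence at a positive distance from
    it. *)
Lemma logder_bounded_closure i : exists M, forall x, closure Omega x -> enorm (logder (Psi i) x) <= M.
Proof.
have fin x := @cifs_some R d N Omega Omega' OO' Psi i x.
case: (mobius_normal (cifs_mobius Psi i)) => [l O b l0 oO E|a b r O r0 oO E].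
  by exists 0 => x _; rewrite E logder_similarity// enorm0.
have nza x : closure Omega x -> x != a.
  by move=> /fin; rewrite E /=; case: ifP.
have na : ~ closure Omega a by move=> /nza; rewrite eqxx.
have : nbhs a (~` closure Omega).
  by apply: open_nbhs_nbhs; split => //; exact/closed_openC/closed_closure.
move=> /nbhs_ballP[e /= e0 He].
exists (2 / e) => x Ox; rewrite E logder_iform ?nza//.
have xe : e <= enorm (x - a).
  apply: le_trans (norm_le_enorm _); rewrite leNgt; apply/negP => xe.
  by apply: (He x) => //; rewrite -ball_normE /= distrC.
have x0 : 0 < enorm (x - a) := lt_le_trans e0 xe.
rewrite enormZ normrN -enorm_sqrE ger0_norm ?divr_ge0 ?sqr_ge0//.
have -> : 2 / enorm (x - a) ^+ 2 * enorm (x - a) = 2 / enorm (x - a) by field; rewrite gt_eqF.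
by rewrite ler_pM2l// lef_pV2.
Qed.

(** Prepending a letter contracts the old term by [l < 1] and adds a bounded one, as in a geometric
    series. *)
Lemma logder_fword_bounded : (exists x, closure Omega x) ->
  exists2 M, 0 < M & forall s x, closure Omega x -> enorm (logder (fword Psi s) x) <= M.
Proof.
move=> nO; have [l [l0 l1 Hl]] := stretch_lambda nO.
have [|M0 M00 HM] := uniform_ub _ logder_bounded_closure.
  by move=> i r s rs H x /H /le_trans; apply.
(* This satisfies [M0 + l M <= M]; the summand 1 makes it positive. *)
pose M := M0 / (1 - l) + 1.
have l1' : 0 < 1 - l by rewrite subr_gt0.
have Mge : M0 + l * M <= M.
  rewrite /M; have -> : M0 + l * (M0 / (1 - l) + 1) = M0 / (1 - l) + l by field; rewrite gt_eqF.
  by rewrite lerD2l ltW.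
have Mpos : 0 < M by rewrite ltr_wpDl// divr_ge0// ltW.
exists M => //; elim=> [|i s IH] x Ox.
  by rewrite fword_nil translationE logder_similarity ?enorm0 ?ltW//; exact: orth1.
have E1 := cifs_some OO' Psi i Ox.
have Oy : closure Omega (fpart (Psi i) x) by apply: subset_closure; exact: cifs_self.
have [_ E2] := fword_closure s Oy.
have -> : fword Psi (i :: s) = fword Psi s \o Psi i by rewrite -cat1s fword_cat.
rewrite (logder_comp d0 (mobius_normal (cifs_mobius Psi i)) (normal_fword s) E1 E2).
have [P [oP s0 dP]] := fpart_conformal d0 (mobius_normal (cifs_mobius Psi i)) E1.
rewrite (jacobian_is_diff dP).
have h1 := HM i x Ox; have h2 := IH _ Oy; have h3 := Hl i x Ox.
move: (stretch (Psi i) x) s0 h3 => S s0 h3.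
move: (logder (Psi i) x) (logder (fword Psi s) _) h1 h2 => T T' h1 h2.
apply: le_trans (enormD _ _) _; apply: le_trans Mge; apply: lerD => //.
rewrite linearZ/= -scalemxAr enormZ gtr0_norm// enorm_orth; last exact: orth_tr.
by apply: ler_pM => //; [exact: ltW|exact: enorm_ge0].
Qed.

Lemma GT_separated : GT Psi -> exists2 delta, 0 < delta & forall s t,
  size s = size t -> ohead s <> ohead t -> exists2 z, closure Omega z &
  delta <= enorm (logder (fword Psi s) z - logder (fword Psi t) z).
Proof.
rewrite /GT /=; set E := ereal_inf _ => E0.
(* A number strictly below the infimum is exceeded at some point for each pair; if the infimum is
   infinite, 1 is taken. *)
have [delta delta0 dE] : exists2 delta : R, 0 < delta & (delta%:E < E)%E.
  move: E0; case: E => [m| |] //; last by exists 1 => //; rewrite ltry.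
  by rewrite lte_fin => m0; exists (m / 2); rewrite ?divr_gt0// lte_fin ltr_pdivrMr// ltr_pMr// ltr1n.
exists delta => // s t st hst.
have : (delta%:E < supn (closure Omega) (fun x => enorm (logder (fword Psi s) x - logder (fword Psi t) x)))%E.
  apply: lt_le_trans dE _; apply: ereal_inf_lbound.
  exists (Fin s, Fin t); rewrite /= ?TfinE//; split => //=; first by rewrite st.
  by case=> /size0nil s0; apply: hst; move: st; rewrite s0 => /esym/size0nil ->.
move=> /ereal_sup_gt[_ [z Oz <-]]; rewrite lte_fin => /ltW dz.
by exists z.
Qed.

Lemma Uset_not_GT : Omega !=set0 -> Uset Psi -> ~ GT Psi.
Proof.
move=> [x0 Ox0] [c _ /= /(kappa_ltP d0 c _ _ N0)[k [k0 kK Hk]]] /GT_separated[delta delta0 sep].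
have cx0 : closure Omega x0 := subset_closure Ox0.
have [M M0 HM] := logder_fword_bounded (ex_intro _ x0 cx0).
have [D D0 HD] : exists2 D, 0 <= D & forall y z, closure Omega y -> closure Omega z -> enorm (y - z) <= D.
  have [B [_ HB]] := compact_bounded (compact_closure bO).
  have HB' y : closure Omega y -> `|y| <= `|B| + 1.
    by apply: HB; rewrite (le_lt_trans (ler_norm B))// ltrDl.
  exists (d%:R * ((`|B| + 1) + (`|B| + 1))); first by rewrite mulr_ge0// !addr_ge0.
  move=> y z /HB' yB /HB' zB; apply: le_trans (enorm_le_norm _) _.
  by rewrite ler_wpM2l// (le_trans (ler_normB _ _))// lerD.
(* The upper and lower chordal bounds at [x0] would contradict each other for [k < 1]. This gives
   [k ^+ size u <= k ^+ n] for prefixes. *)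
have k1 : 1 <= k.
  pose i := Ordinal N0; have fx := cifs_some OO' Psi i cx0.
  have l1 := Hk i _ _ fx; have l2 := kbound_lower d0 k0 (cifs_mobius Psi i) (Hk i) fx.
  rewrite leNgt; apply/negP => kl1.
  have := dot_ge0 (fpart (Psi i) x0 - c).
  move: l1 l2; rewrite -mulrA.
  move: (dot (fpart _ _ - c) _) (stretch _ _ * _) => n p l1 l2 n0.
  have : k * p <= k * (k * (1 + n)) by rewrite ler_pM2l.
  have : k * (1 + n) < 1 + n by rewrite gtr_pMl// ltr_wpDr.
  have : k * (k * (1 + n)) <= 1 * (k * (1 + n)) by rewrite ler_wpM2r ?ltW// mulr_gt0// ltr_wpDr.
  lra.
pose L2 := (1 + D * M / 2) ^+ 2.
have L20 : 0 < L2 by rewrite exprn_gt0// ltr_wpDr// divr_ge0// mulr_ge0// ltW.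
pose n0 := 1 + dot (x0 - c) (x0 - c).
have n00 : 0 < n0 by rewrite ltr_wpDr// dot_ge0.
(* The factor [L2] is lost in changing the point of comparison, [n0] in the lower bound on the
   stretch. *)
pose c1 := delta / L2 / n0.
have c10 : 0 < c1 by rewrite !divr_gt0.
have sepn n (w w' : n.-tuple 'I_N) : w != w' ->
    c1 / k ^+ n <= enorm (logder (fword Psi w) x0 - logder (fword Psi w') x0).
  move=> ww'; have szE : size w = size w' by rewrite !size_tuple.
  have neq : (w : seq _) <> w' by move=> E; move/eqP: ww'; apply; exact: val_inj.
  have [u [i [j [s [t [Es Et st ij]]]]]] := seq_first_difference szE neq.
  have su : (size u <= n)%N by rewrite -(size_tuple w) Es size_cat leq_addr.
  rewrite Es Et !fword_cat.
  have [Oy Ey] := fword_closure u cx0.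
  have [_ E1] := fword_closure (i :: s) Oy; have [_ E2] := fword_closure (j :: t) Oy.
  rewrite (logder_compB d0 (normal_fword u) (normal_fword _) (normal_fword _) Ey E1 E2).
  (* Separation holds at a point [z] depending on the words; [logder_distortion] moves it to the
     image of [x0] under the common prefix. *)
  have [||z Oz sz] := sep (i :: s) (j :: t); first by rewrite /= st.
    by case.
  have [_ F1] := fword_closure (i :: s) Oz; have [_ F2] := fword_closure (j :: t) Oz.
  have dist := logder_distortion d0 (normal_fword (i :: s)) (normal_fword (j :: t)) M0 D0 E1 F1 E2 F2
    (HD _ _ Oy Oz) (HM _ _ Oz) (HM _ _ Oz).
  have low := stretch_fword_lower u k0 Hk cx0.
  have dE : delta <= L2 * enorm (logder (fword Psi (i :: s)) (fpart (fword Psi u) x0) -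
    logder (fword Psi (j :: t)) (fpart (fword Psi u) x0)) := le_trans sz dist.
  have [_ [_ S0 _]] := fpart_conformal d0 (normal_fword u) Ey.
  move: dE low S0; move: (enorm _) (enorm_ge0 (logder (fword Psi (i :: s)) (fpart (fword Psi u) x0) -
    logder (fword Psi (j :: t)) (fpart (fword Psi u) x0))) (stretch _ _) => e e0 S dE low S0.
  have kn0 : 0 < k ^+ n by rewrite exprn_gt0.
  rewrite /c1 ler_pdivrMr// ler_pdivrMr// ler_pdivrMr//.
  apply: le_trans dE _.
  have -> : S * e * k ^+ n * n0 * L2 = L2 * e * (k ^+ n * S * n0) by ring.
  apply: ler_peMr; first by rewrite mulr_ge0// ltW.
  apply: le_trans low _; rewrite -/n0 ler_pM2r// ler_pM2r//.
  exact: ler_weXn2l.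
(* As [1 <= k^n], the base [2 M d k^n / c1 + 1] of the packing bound is at most [C k^n]. *)
pose C := 2 * M * d%:R / c1 + 1.
have MR0 : 0 <= 2 * M * d%:R by apply: mulr_ge0; [exact/mulr_ge0/ltW|exact: ler0n].
have C0 : 0 < C by apply: ltr_wpDl ltr01; exact: divr_ge0 MR0 (ltW c10).
have kd : k ^+ d < N%:R.
  have -> : N%:R = (N%:R `^ d%:R^-1) ^+ d :> R.
    by rewrite -powR_mulrn ?powR_ge0// -powRrM mulVf ?powRr1// pnatr_eq0 -lt0n.
  by rewrite ltrXn2r// ?nnegrE ?powR_ge0 ?(ltW k0)// gt_eqF.
have kd0 : 0 < k ^+ d by rewrite exprn_gt0.
(* Some [n] has [N^n > (C k^n)^d], against the packing bound for words of length [n]. *)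
have [|n] := @geometric_unbounded R (N%:R / k ^+ d) (C ^+ d); first by rewrite ltr_pdivlMr// mul1r.
have kn0 : 0 < k ^+ n by rewrite exprn_gt0.
rewrite expr_div_n ltr_pdivlMr ?exprn_gt0//; apply/negP; rewrite -leNgt.
have sep0 : 0 < c1 / k ^+ n by rewrite divr_gt0.
have := card_separated d0 (ltW M0) sep0 (fun w : n.-tuple 'I_N => HM w x0 cx0) (@sepn n).
rewrite card_tuple card_ord natrX => /le_trans; apply.
rewrite -exprM mulnC exprM -exprMn; apply: lerXn2r; rewrite ?nnegrE.
- by rewrite addr_ge0//; exact: divr_ge0 MR0 (ltW sep0).
- by rewrite mulr_ge0 ?(ltW C0) ?(ltW kn0).
- rewrite /C [leRHS]mulrDl mul1r invfM invrK mulrA lerD2l.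
  exact: exprn_ege1.
Qed.

End Words.

(** * Homotheties *)

Section Homotheties.
Context {R : realType} {d : nat} (d0 : (0 < d)%N).
Local Notation V := 'rV[R]_d.
Implicit Types (a b c x y : V) (r : R).

(** For [x] on the boundary, convexity is applied to a nearby point of [Omega] and a correspondingly
    shifted centre. *)
Lemma convex_homothety (Omega : set V) a x r : open Omega ->
  convex_set (M := 'rV[R]_d) Omega -> 0 < r -> r < 1 -> Omega a -> closure Omega x ->
  Omega (r *: (x - a) + a).
Proof.
move=> oO cO r0 r1 Oa Ox.
have r1' : 1 - r != 0 by rewrite gt_eqF// subr_gt0.
(* The combination [r y + (1 - r) g y] is the image of [x] for every [y], and [g x = a] lies in the
   open set. *)
pose g y : V := (r / (1 - r)) *: (x - y) + a.
have cg : {for x, continuous g}.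
  have := is_diffD (is_diffZ (r / (1 - r)) (is_diffB (is_diff_cst x x) (is_diff_id x))) (is_diff_cst a x).
  by move=> [D _]; exact: differentiable_continuous D.
have gx : nbhs x [set y | Omega (g y)].
  apply: (cg Omega); apply: open_nbhs_nbhs; split => //.
  by rewrite /g subrr scaler0 add0r.
have [x' [Ox' gx']] := Ox _ gx.
pose l := Itv01 (ltW r0) (ltW r1).
have : Omega (r *: x' + (1 - r) *: g x') := set_mem (cO x' (g x') l (mem_set Ox') (mem_set gx')).
congr Omega; apply/rowP => j; rewrite /g !mxE; field.
by rewrite r1'.
Qed.

Definition homothety r c : rhat R d -> rhat R d := omap (fun x => r *: (x - c) + c).

Lemma homothetyE r c : homothety r c = similarity r 1%:M ((1 - r) *: c).
Proof.
apply/funext => -[x|//] /=; congr Some; rewrite mulmx1.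
by apply/rowP => j; rewrite !mxE; ring.
Qed.

Lemma stretch_homothety r c x : 0 < r -> stretch (homothety r c) x = r.
Proof. by move=> r0; rewrite homothetyE stretch_similarity//; exact: orth1. Qed.

(** For [a = c] the bound is [1 / r]. With [u = x - c] and [v = a - c], the cross term is controlled
    by [2 |u| |v| <= e (1 + |u|^2)], which worsens the bound to at most [1 / (r - e)]. *)
Lemma kbound_homothety r e a c : 0 < r -> r < 1 -> e < r -> enorm (a - c) < e ->
  kbound c (r - e)^-1 (homothety r a).
Proof.
move=> r0 r1 er ac x y /= [<-]; rewrite stretch_homothety//.
have -> : r *: (x - a) + a - c = r *: (x - c) + (1 - r) *: (a - c).
  by apply/rowP => j; rewrite !mxE; ring.
move: (x - c) (a - c) ac => u v ve.
rewrite ler_pdivlMl ?subr_gt0//.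
have uv : - (2 * enorm u * e) <= 2 * dot u v.
  have := dot_norm_le u v; rewrite ler_norml => /andP[h _].
  have : enorm u * enorm v <= enorm u * e by rewrite ler_wpM2l ?enorm_ge0// ltW.
  lra.
rewrite !dotsE (dotC v u).
have e0 : 0 < e := le_lt_trans (enorm_ge0 _) ve.
have vv := dot_ge0 v.
have u2 : 2 * enorm u <= 1 + dot u u.
  by rewrite -enorm_sqrE; have := sqr_ge0 (enorm u - 1); rewrite !expr2; lra.
have h1 : - (e * (1 + dot u u)) <= 2 * dot u v by have := ler_wpM2l (ltW e0) u2; lra.
have h2 : r * (1 - r) * - (e * (1 + dot u u)) <= r * (1 - r) * (2 * dot u v).
  by rewrite ler_wpM2l// mulr_ge0 ?(ltW r0)// subr_ge0 ltW.
have h3 : 0 <= (1 - r) * ((1 - r) * dot v v) by rewrite !mulr_ge0// subr_ge0 ltW.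
have h4 : 0 <= e * (1 + dot u u) by rewrite mulr_ge0 ?(ltW e0)// addr_ge0// dot_ge0.
have h5 : 0 <= r * r * (e * (1 + dot u u)) by do 2?[apply: mulr_ge0 => //]; exact: ltW.
have h6 : r * r <= 1 by apply: mulr_ile1; exact: ltW.
nra.
Qed.

Context {N : nat} {Omega Omega' : set V}.

Lemma homothety_cifs r (ci : 'I_N -> V) : open Omega ->
  convex_set (M := 'rV[R]_d) Omega -> 0 < r -> r < 1 -> (forall i, Omega (ci i)) ->
  exists Psi : cifs N Omega Omega', forall i, Psi i = homothety r (ci i).
Proof.
move=> oO cO r0 r1 Oci.
have mob i : mobius (homothety r (ci i)).
  by rewrite homothetyE; apply: mobius_similarity => //; exact: orth1.
have fin i x : Omega' x -> homothety r (ci i) (Some x) <> None by [].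
have self i x : closure Omega x -> Omega (fpart (homothety r (ci i)) x).
  exact: convex_homothety.
have contr i x : closure Omega x -> opnorm ('J (fpart (homothety r (ci i))) x) < 1.
  by move=> _; rewrite -stretchE stretch_homothety.
by exists (Cifs mob fin self contr).
Qed.

End Homotheties.

Theorem proposition11p12 (R : realType) (d N : nat) (hd : (3 <= d)%N) (hN : (2 <= N)%N) :
  (forall Omega Omega' : set 'rV[R]_d,
     domain Omega -> bounded_set Omega -> domain Omega' -> closure Omega `<=` Omega' ->
     [/\ open (@Uset R d N Omega Omega'),
         @Uset R d N Omega Omega' `&` closure (@GT R d N Omega Omega') = set0 &
         @Uset R d N Omega Omega' `<=`
           [set Psi | ((N%:R `^ (- d%:R^-1))%:E < lambda_max Psi)%E]]) /\
  (forall r : R, N%:R `^ (- d%:R^-1) < r -> r < 1 ->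
     exists2 e : R, 0 < e &
       forall Omega Omega' : set 'rV[R]_d,
         domain Omega -> bounded_set Omega -> domain Omega' -> closure Omega `<=` Omega' ->
         convex_set (M := 'rV[R]_d) Omega ->
         forall c : 'rV[R]_d, Omega c ->
         forall ci : 'I_N -> 'rV[R]_d,
           (forall i, Omega (ci i) /\ enorm (ci i - c) < e) ->
           exists2 Psi : cifs N Omega Omega',
             (forall i, Psi i = omap (fun x => r *: (x - ci i) + ci i)) & Uset Psi) /\
  (forall Omega Omega' : set 'rV[R]_d,
     domain Omega -> bounded_set Omega -> domain Omega' -> closure Omega `<=` Omega' ->
     convex_set (M := 'rV[R]_d) Omega ->
     ~ dense (@GT R d N Omega Omega')).
Proof.
have d0 : (0 < d)%N by apply: leq_trans hd.
have N0 : (0 < N)%N by apply: leq_trans hN.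
pose K : R := N%:R `^ d%:R^-1.
have K0 : 0 < K by rewrite powR_gt0// ltr0n.
have disjoint (Omega Omega' : set 'rV[R]_d) : domain Omega -> bounded_set Omega ->
    closure Omega `<=` Omega' -> forall Psi : cifs N Omega Omega', Uset Psi -> ~ GT Psi.
  by move=> [nO _ _] bO OO' Psi; exact: Uset_not_GT.
have homotheties (r : R) : K^-1 < r -> r < 1 -> exists2 e : R, 0 < e &
    forall Omega Omega' : set 'rV[R]_d, domain Omega ->
      convex_set (M := 'rV[R]_d) Omega -> forall (c : 'rV[R]_d) (ci : 'I_N -> 'rV[R]_d),
      (forall i, Omega (ci i) /\ enorm (ci i - c) < e) ->
      exists2 Psi : cifs N Omega Omega',
        (forall i, Psi i = homothety r (ci i)) & Uset Psi.
  move=> Kr r1; have r0 : 0 < r by apply: lt_trans Kr; rewrite invr_gt0.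
  (* Then [r - e] is the midpoint of [K^-1] and [r], so [1 / (r - e) < K]. *)
  exists ((r - K^-1) / 2); first by rewrite divr_gt0// subr_gt0.
  move=> Omega Omega' [_ _ oO] cO c ci Hci.
  have [|Psi HPsi] := @homothety_cifs R d d0 N Omega Omega' r ci oO cO r0 r1.
    by move=> i; case: (Hci i).
  exists Psi => //; exists c => //; apply/(kappa_ltP d0 c _ _ N0).
  have Ki0 : 0 < K^-1 by rewrite invr_gt0.
  have er : (r - K^-1) / 2 < r by lra.
  exists (r - (r - K^-1) / 2)^-1; split.
  - by rewrite invr_gt0 subr_gt0.
  - rewrite -/K -[ltRHS]invrK ltf_pV2 ?posrE ?subr_gt0//; lra.
  - by move=> i; rewrite HPsi; apply: kbound_homothety => //; case: (Hci i).
split; [|split].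
- move=> Omega Omega' dO bO dO' OO'; split.
  + exact: open_Uset.
  + rewrite -subset0 => Psi [UPsi cPsi].
    have nU : nbhs Psi (@Uset R d N Omega Omega').
      by apply: open_nbhs_nbhs; split => //; exact: open_Uset.
    have [Phi [GPhi UPhi]] := cPsi _ nU.
    exact: disjoint UPhi GPhi.
  + by move=> Psi UPsi; exact: Uset_lambda_max.
- move=> r; rewrite powRN -/K => Kr r1; have [e e0 He] := homotheties r Kr r1.
  exists e => // Omega Omega' dO _ _ _ cO c _ ci Hci.
  exact: He dO cO c ci Hci.
- move=> Omega Omega' dO bO dO' OO' cO dn.
  (* Since [N >= 2], there are ratios between [K^-1] and 1. *)
  have K1 : 1 < K.
    rewrite ltNge; apply/negP => K1.
    have KN : K ^+ d = N%:R.
      by rewrite -powR_mulrn ?powR_ge0// -powRrM mulVf ?powRr1// pnatr_eq0 -lt0n.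
    have := exprn_ile1 d (ltW K0) K1; rewrite KN.
    by rewrite lern1 leqNgt hN.
  have Ki1 : K^-1 < 1 by rewrite invf_lt1.
  have [||e e0 He] := homotheties ((1 + K^-1) / 2); [lra|lra|].
  have [[c Oc] _ _] := dO.
  (* Equal centres suffice to make the open set nonempty. *)
  have [|Psi _ UPsi] := He Omega Omega' dO cO c (fun=> c).
    by split; rewrite ?subrr ?enorm0.
  have [Phi [UPhi GPhi]] := dn _ (ex_intro _ Psi UPsi) (open_Uset d0 N0 OO' dO).
  exact: disjoint UPhi GPhi.
Qed.
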